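(* Let $n\ge1$ and let $\Omega\subset\mathbb R^{n+1}$ be a domain with nonempty $C^2$ boundary, with distance function $\delta$ to the boundary. Then $\delta$ is superharmonic on $\Omega$ off the singular set $S$, i.e. $-\Delta\delta(x)\ge0$ for all $x\in G=\Omega\setminus S$, if and only if $\partial\Omega$ is weakly mean convex, i.e. $H(y)\ge0$ for all $y\in\partial\Omega$.
   Context: A domain is an open connected subset of Euclidean space; its boundary is $C^2$ if near each boundary point the domain is, after a rotation, the region on one side of the graph of a $C^2$ function. $\delta(x)=\inf_{y\in\mathbb R^{n+1}\setminus\Omega}|x-y|$. For $y\in\partial\Omega$, $\kappa_1(y),\dots,\kappa_n(y)$ are the principal curvatures of $\partial\Omega$ at $y$ with respect to the outward unit normal, with the sign convention that they all equal $1$ when $\Omega$ is the unit ball, and $H(y)=\sum_{i=1}^n\kappa_i(y)$ is the mean curvature. The good set $G\subset\Omega$ is the largest open subset of $\Omega$ such that every $x\in G$ has a unique nearest point on $\partial\Omega$; $S=\Omega\setminus G$ is the singular set. One has $\delta\in C^2(G)$, so $\Delta\delta$ is defined classically on $G$. *)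

(* Defs.v *)
From HB Require Import structures.
From mathcomp Require Import all_boot all_order all_algebra.
From mathcomp Require Import all_classical all_reals all_analysis.

Set Implicit Arguments.
Unset Strict Implicit.
Unset Printing Implicit Defensive.

Import Order.TTheory GRing.Theory Num.Theory.
Import numFieldNormedType.Exports.

Local Open Scope classical_set_scope.
Local Open Scope ring_scope.

(* The library norm on 'rV[R]_n is the sup norm; it is used here only for the
   topology and for differentiability, distances being measured by enorm. *)
Definition dotv (R : realType) (n : nat) (u v : 'rV[R]_n) : R :=
  \sum_(i < n) u 0 i * v 0 i.

Definition enorm (R : realType) (n : nat) (u : 'rV[R]_n) : R :=
  Num.sqrt (dotv u u).

Definition partial (R : realType) (n : nat) (i : 'I_n) (f : 'rV[R]_n -> R) :
  'rV[R]_n -> R := fun x => 'D_(delta_mx 0 i) f x.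

Definition laplacian (R : realType) (n : nat) (f : 'rV[R]_n -> R)
  (x : 'rV[R]_n) : R := \sum_(i < n) partial i (partial i f) x.

Definition C1_fun (R : realType) (n : nat) (f : 'rV[R]_n -> R) : Prop :=
  (forall x, differentiable f x) /\ forall i, continuous (partial i f).

Definition C2_fun (R : realType) (n : nat) (f : 'rV[R]_n -> R) : Prop :=
  C1_fun f /\ forall i, C1_fun (partial i f).

Definition bdry (R : realType) (n : nat) (Omega : set 'rV[R]_n) :
  set 'rV[R]_n := closure Omega `\` interior Omega.

Definition rotation (R : realType) (n : nat) (Q : 'M[R]_n) : Prop :=
  Q *m Q^T = 1%:M /\ \det Q = 1.

(* x *m Q is the rotated point: its last coordinate is the height and
   col' ord_max removes that coordinate.  The region below a graph need not be
   listed: for n >= 1 a rotation exchanges the two sides. *)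
Definition C2_boundary (R : realType) (n : nat) (Omega : set 'rV[R]_n.+1) :
  Prop :=
  forall y, bdry Omega y ->
    exists (Q : 'M[R]_n.+1) (f : 'rV[R]_n -> R),
      [/\ rotation Q, C2_fun f &
          \forall x \near y,
            Omega x <-> f (col' ord_max (x *m Q)) < (x *m Q) 0 ord_max].

Definition dist_bdry (R : realType) (n : nat) (Omega : set 'rV[R]_n)
  (x : 'rV[R]_n) : R := inf [set enorm (x - y) | y in ~` Omega].

Definition nearest_point (R : realType) (n : nat) (A : set 'rV[R]_n)
  (x y : 'rV[R]_n) : Prop :=
  A y /\ forall z, A z -> enorm (x - y) <= enorm (x - z).

(* The largest open subset, as the union of all the candidates. *)
Definition good_set (R : realType) (n : nat) (Omega : set 'rV[R]_n) :
  set 'rV[R]_n :=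
  \bigcup_(U in [set U : set 'rV[R]_n | [/\ open U, U `<=` Omega &
      forall x, U x -> exists! y, nearest_point (bdry Omega) x y]]) U.

Definition singular_set (R : realType) (n : nat) (Omega : set 'rV[R]_n) :
  set 'rV[R]_n := Omega `\` good_set Omega.

Definition tangent_vector (R : realType) (n : nat) (M : set 'rV[R]_n)
  (y w : 'rV[R]_n) : Prop :=
  exists gamma : R -> 'rV[R]_n,
    [/\ gamma 0 = y, \forall t \near 0, M (gamma t) & is_derive (0 : R) (1 : R) gamma w].

Definition outward_unit_normal (R : realType) (n : nat) (Omega : set 'rV[R]_n)
  (y v : 'rV[R]_n) : Prop :=
  [/\ enorm v = 1,
      forall w, tangent_vector (bdry Omega) y w -> dotv w v = 0 &
      \forall t \near (0 : R)^'+,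
        Omega (y - t *: v) /\ ~ closure Omega (y + t *: v)].

(* The k_i are the eigenvalues, with multiplicity, of the differential at y of
   the outward unit normal, as an endomorphism of the tangent space: N is a
   differentiable extension of the normal near y, and the rows of B form an
   orthonormal basis of the tangent space.  For the unit ball N z = z, hence
   all the k_i are 1. *)
Definition are_principal_curvatures (R : realType) (n : nat)
  (Omega : set 'rV[R]_n.+1) (y : 'rV[R]_n.+1) (k : 'rV[R]_n) : Prop :=
  exists (N : 'rV[R]_n.+1 -> 'rV[R]_n.+1) (B : 'M[R]_(n, n.+1)),
    [/\ differentiable N y,
        \forall z \near y, bdry Omega z -> outward_unit_normal Omega z (N z),
        B *m B^T = 1%:M,
        forall i, tangent_vector (bdry Omega) y (row i B) &
        char_poly (\matrix_(i, j) dotv ('d N y (row i B)) (row j B))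
          = \prod_(i < n) ('X - (k 0 i)%:P)].

(* Such a k exists at each point of a C^2 boundary and is unique up to the
   order of its entries; 0 is a dummy value elsewhere. *)
Definition principal_curvatures (R : realType) (n : nat)
  (Omega : set 'rV[R]_n.+1) (y : 'rV[R]_n.+1) : 'rV[R]_n :=
  xget 0 [set k | are_principal_curvatures Omega y k].

Definition mean_curvature (R : realType) (n : nat) (Omega : set 'rV[R]_n.+1)
  (y : 'rV[R]_n.+1) : R :=
  \sum_(i < n) principal_curvatures Omega y 0 i.

Definition weakly_mean_convex (R : realType) (n : nat)
  (Omega : set 'rV[R]_n.+1) : Prop :=
  forall y, bdry Omega y -> 0 <= mean_curvature Omega y.

(* Main.v *)
Require Import Defs.
From HB Require Import structures.
From mathcomp Require Import all_boot all_order all_algebra.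
From mathcomp Require Import all_classical all_reals all_analysis.
From mathcomp Require Import ring lra complex.

Set Implicit Arguments.
Unset Strict Implicit.
Unset Printing Implicit Defensive.

Import Order.TTheory GRing.Theory Num.Theory.
Import numFieldNormedType.Exports.

Local Open Scope classical_set_scope.
Local Open Scope ring_scope.

(* Near a boundary point Omega is {F < 0}; put N = grad F / |grad F| and let L be
   the matrix of dN, so that tr L = H.  On the good set x = y(x) - r N(y(x)) with
   r = delta(x), and grad delta = - N(y(x)).  Since a good point has a good
   neighbourhood, where delta grows at rate 1, there is a larger ball of Omega
   touching the boundary at y(x); hence 1 - rL is injective and y is
   differentiable at x, with matrix P = Pi + r P L, where Pi is the orthogonal
   projection onto the tangent space.  Therefore
     - lap delta = tr (PL) = tr L + r tr (P L L),
   and tr (P L L) >= 0 because P is positive (nearest point maps are monotone).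
   This gives one direction.  Conversely, y0 - t N(y0) is a good point for small
   t > 0, and tr (P L L) stays bounded as t -> 0, so that H(y0) >= 0. *)

(** * The Euclidean structure *)

(** The obstacle is circularity: neither delta nor the nearest point map y is known to be smooth,
    and each is expressed through the other. Differentiability is therefore proved one point at a
    time, without an inverse or implicit function theorem, by three devices. The height direction
    [q] of a local graph gives explicit curves in the boundary. A product is differentiable where
    one factor vanishes and is differentiable and the other is merely continuous; this handles
    (delta - r) N(y) before y is known to be differentiable. A continuous map becomes differentiable
    once its composite with a map of invertible differential is. Continuity of y itself comes from
    compactness and uniqueness of nearest points. Vectors are rows and matrices act on the right, so
    PL means first P, then L. *)

Lemma dotvE (R : realType) n (u v : 'rV[R]_n) : dotv u v = (u *m v^T) 0 0.
Proof. by rewrite mxE; apply: eq_bigr => i _; rewrite mxE. Qed.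

Lemma dotvC (R : realType) n (u v : 'rV[R]_n) : dotv u v = dotv v u.
Proof. by apply: eq_bigr => i _; rewrite mulrC. Qed.

Lemma dotvDl (R : realType) n (u v w : 'rV[R]_n) :
  dotv (u + v) w = dotv u w + dotv v w.
Proof. by rewrite !dotvE mulmxDl mxE. Qed.

Lemma dotvZl (R : realType) n a (u v : 'rV[R]_n) :
  dotv (a *: u) v = a * dotv u v.
Proof. by rewrite !dotvE -scalemxAl mxE. Qed.

Lemma dotvDr (R : realType) n (u v w : 'rV[R]_n) :
  dotv w (u + v) = dotv w u + dotv w v.
Proof. by rewrite dotvC dotvDl ![dotv _ w]dotvC. Qed.

Lemma dotvZr (R : realType) n a (u v : 'rV[R]_n) :
  dotv u (a *: v) = a * dotv u v.
Proof. by rewrite dotvC dotvZl dotvC. Qed.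

Lemma dotvNl (R : realType) n (u v : 'rV[R]_n) : dotv (- u) v = - dotv u v.
Proof. by rewrite -scaleN1r dotvZl mulN1r. Qed.

Lemma dotvNr (R : realType) n (u v : 'rV[R]_n) : dotv u (- v) = - dotv u v.
Proof. by rewrite -scaleN1r dotvZr mulN1r. Qed.

Lemma dotvBl (R : realType) n (u v w : 'rV[R]_n) :
  dotv (u - v) w = dotv u w - dotv v w.
Proof. by rewrite dotvDl dotvNl. Qed.

Lemma dotvBr (R : realType) n (u v w : 'rV[R]_n) :
  dotv w (u - v) = dotv w u - dotv w v.
Proof. by rewrite dotvDr dotvNr. Qed.

Lemma dotv0l (R : realType) n (u : 'rV[R]_n) : dotv 0 u = 0.
Proof. by rewrite dotvE mul0mx mxE. Qed.

Lemma dotv0r (R : realType) n (u : 'rV[R]_n) : dotv u 0 = 0.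
Proof. by rewrite dotvC dotv0l. Qed.

Definition dotv_lin := (dotvDl, dotvDr, dotvNl, dotvNr, dotvZl, dotvZr).

Lemma dotv_ge0 (R : realType) n (u : 'rV[R]_n) : 0 <= dotv u u.
Proof. by apply: sumr_ge0 => i _; rewrite -expr2 sqr_ge0. Qed.

Lemma dotv_eq0 (R : realType) n (u : 'rV[R]_n) : (dotv u u == 0) = (u == 0).
Proof.
apply/eqP/eqP => [|->]; last by rewrite dotv0l.
move=> /eqP; rewrite psumr_eq0 => [|i _]; last by rewrite -expr2 sqr_ge0.
move=> /allP h; apply/rowP => i; rewrite mxE.
by have := h i (mem_index_enum i); rewrite -expr2 sqrf_eq0 => /eqP.
Qed.

Lemma dotv_deltar (R : realType) n (u : 'rV[R]_n) i :
  dotv u (delta_mx 0 i) = u 0 i.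
Proof.
rewrite /dotv (bigD1 i) //= mxE !eqxx mulr1 big1 ?addr0// => j ji.
by rewrite mxE (negPf ji) mulr0.
Qed.

Lemma dotv_mulmx (R : realType) m n (u : 'rV[R]_m) (A : 'M[R]_(m, n)) v :
  dotv (u *m A) v = dotv u (v *m A^T).
Proof. by rewrite !dotvE trmx_mul trmxK mulmxA. Qed.

Lemma enorm_ge0 (R : realType) n (u : 'rV[R]_n) : 0 <= enorm u.
Proof. exact: sqrtr_ge0. Qed.

Lemma sqr_enorm (R : realType) n (u : 'rV[R]_n) : enorm u ^+ 2 = dotv u u.
Proof. by rewrite sqr_sqrtr// dotv_ge0. Qed.

Lemma enorm_eq0 (R : realType) n (u : 'rV[R]_n) : (enorm u == 0) = (u == 0).
Proof. by rewrite -sqrf_eq0 sqr_enorm dotv_eq0. Qed.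

Lemma enorm0 (R : realType) n : enorm (0 : 'rV[R]_n) = 0.
Proof. by apply/eqP; rewrite enorm_eq0. Qed.

Lemma enorm_gt0 (R : realType) n (u : 'rV[R]_n) : (0 < enorm u) = (u != 0).
Proof. by rewrite lt0r enorm_ge0 andbT enorm_eq0. Qed.

Lemma enormZ (R : realType) n a (u : 'rV[R]_n) : enorm (a *: u) = `|a| * enorm u.
Proof.
by rewrite /enorm dotvZl dotvZr mulrA -expr2 sqrtrM ?sqr_ge0// sqrtr_sqr.
Qed.

Lemma enormN (R : realType) n (u : 'rV[R]_n) : enorm (- u) = enorm u.
Proof. by rewrite -scaleN1r enormZ normrN1 mul1r. Qed.

Lemma enormBC (R : realType) n (u v : 'rV[R]_n) : enorm (u - v) = enorm (v - u).
Proof. by rewrite -enormN opprB. Qed.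

Lemma enorm_le_sqr (R : realType) n (u v : 'rV[R]_n) :
  (enorm u <= enorm v) = (dotv u u <= dotv v v).
Proof. by rewrite -!sqr_enorm ler_sqr ?nnegrE ?enorm_ge0. Qed.

Lemma dotv_cauchy (R : realType) n (u v : 'rV[R]_n) :
  `|dotv u v| <= enorm u * enorm v.
Proof.
have [->|v0] := eqVneq v 0; first by rewrite dotv0r normr0 enorm0 mulr0.
rewrite -ler_sqr ?nnegrE ?mulr_ge0 ?enorm_ge0// exprMn !sqr_enorm.
have vv : 0 < dotv v v by rewrite lt0r dotv_eq0 v0 dotv_ge0.
have := dotv_ge0 (u - (dotv u v / dotv v v) *: v).
rewrite !dotv_lin ![dotv v u]dotvC real_normK ?num_real//.
set a := dotv u u; set b := dotv u v; set c := dotv v v in vv *.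
rewrite [leRHS](_ : _ = a - b ^+ 2 / c); last by field; rewrite gt_eqF.
by rewrite subr_ge0 ler_pdivrMr.
Qed.

Lemma dotv_le_enorm (R : realType) n (u v : 'rV[R]_n) :
  dotv u v <= enorm u * enorm v.
Proof. exact: le_trans (ler_norm _) (dotv_cauchy _ _). Qed.

Lemma dotvBB (R : realType) n (u v : 'rV[R]_n) :
  dotv (u - v) (u - v) = dotv u u - 2 * dotv u v + dotv v v.
Proof. by rewrite !dotv_lin ![dotv v u]dotvC; ring. Qed.

Lemma dotvDD (R : realType) n (u v : 'rV[R]_n) :
  dotv (u + v) (u + v) = dotv u u + 2 * dotv u v + dotv v v.
Proof. by rewrite !dotv_lin ![dotv v u]dotvC; ring. Qed.

Lemma enormD (R : realType) n (u v : 'rV[R]_n) :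
  enorm (u + v) <= enorm u + enorm v.
Proof.
rewrite -ler_sqr ?nnegrE ?addr_ge0 ?enorm_ge0// sqr_enorm sqrrD !sqr_enorm.
by rewrite dotvDD lerD2r lerD2l mulr_natl lerMn2r dotv_le_enorm.
Qed.

Lemma enorm_triangle (R : realType) n (x y z : 'rV[R]_n) :
  enorm (x - z) <= enorm (x - y) + enorm (y - z).
Proof. by rewrite -(subrKA y x (-z)) enormD. Qed.

Lemma enorm_sub_dist (R : realType) n (u v : 'rV[R]_n) :
  `|enorm u - enorm v| <= enorm (u - v).
Proof.
have h (a b : 'rV[R]_n) : enorm a - enorm b <= enorm (a - b).
  by rewrite lerBlDr -{1}(subrK b a) enormD.
by rewrite ler_norml h andbT lerNl opprB enormBC h.
Qed.

Lemma coord_le_norm (R : realType) n (u : 'rV[R]_n) i : `|u 0 i| <= `|u|.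
Proof.
rewrite [leRHS]/Num.Def.normr/= mx_normrE.
exact: (le_bigmax _ (fun i : 'I_1 * 'I_n => `|u i.1 i.2|) (0, i)).
Qed.

Lemma norm_le_enorm (R : realType) n (u : 'rV[R]_n) : `|u| <= enorm u.
Proof.
rewrite [leLHS]/Num.Def.normr/= mx_normrE (bigmax_le _ (enorm_ge0 _))//=.
move=> [k i] _ /=; rewrite (ord1 k) -ler_sqr ?nnegrE ?enorm_ge0//.
rewrite sqr_enorm real_normK ?num_real// /dotv (bigD1 i) //= -expr2 lerDl.
by apply: sumr_ge0 => j _; rewrite -expr2 sqr_ge0.
Qed.

Lemma dotv_le_norm (R : realType) n (u v : 'rV[R]_n) :
  `|dotv u v| <= n%:R * `|u| * `|v|.
Proof.
apply: le_trans (ler_norm_sum _ _ _) _.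
have -> : n%:R * `|u| * `|v| = \sum_(i < n) `|u| * `|v|.
  by rewrite sumr_const card_ord -[RHS]mulr_natl mulrA.
by apply: ler_sum => i _; rewrite normrM ler_pM ?coord_le_norm.
Qed.

Lemma enorm_le_norm (R : realType) n (u : 'rV[R]_n) : enorm u <= n%:R * `|u|.
Proof.
rewrite -ler_sqr ?nnegrE ?enorm_ge0 ?mulr_ge0// sqr_enorm.
apply: le_trans (ler_norm _) (le_trans (dotv_le_norm _ _) _).
rewrite exprMn expr2 mulrA ler_wpM2r// ler_wpM2r//.
by case: (n) => [|m]; rewrite ?expr2 ?mulr0// ler_peMl// ler1n.
Qed.

(** The bridge between the two norms: neighbourhoods are those of the sup norm, distances are
    Euclidean, and each norm bounds the other up to the factor [n]. *)
Lemma near_enorm (R : realType) n (x : 'rV[R]_n) (P : set 'rV[R]_n) :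
  (\forall y \near x, P y) <->
  (exists2 e, 0 < e & forall y, enorm (y - x) < e -> P y).
Proof.
split=> [/nbhs_ballP[e /= e0 eP]|[e e0 eP]].
  exists e => // y yx; apply: eP; rewrite -ball_normE /ball_ /=.
  by rewrite distrC (le_lt_trans (norm_le_enorm _)).
(* Adding 1 keeps the divisor positive when [n = 0]. *)
have n1 : 0 < n%:R + 1 :> R by rewrite ltr_wpDl.
apply/nbhs_ballP; exists (e / (n%:R + 1)) => [|y]; first by rewrite /= divr_gt0.
rewrite -ball_normE /ball_ /= distrC ltr_pdivlMr// => yx; apply: eP.
apply: le_lt_trans (enorm_le_norm _) (le_lt_trans _ yx).
by rewrite mulrC ler_wpM2l// lerDl.
Qed.

Lemma continuous_enorm (R : realType) n : continuous (@enorm R n).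
Proof.
move=> x; have xF : Filter (nbhs x) := nbhs_filter x.
apply/cvgrPdist_le => e e0; apply/near_enorm; exists e => // y yx.
by rewrite (le_trans (enorm_sub_dist _ _))// enormBC ltW.
Qed.

Lemma mulmx_le_norm (R : realType) m n (A : 'M[R]_(m, n)) :
  exists2 C, 0 < C & forall u : 'rV[R]_m, `|u *m A| <= C * `|u|.
Proof.
have C0 : 0 < m%:R * `|A^T| + 1 by rewrite ltr_wpDl// mulr_ge0.
exists (m%:R * `|A^T| + 1) => // u.
rewrite [leLHS]/Num.Def.normr/= mx_normrE bigmax_le ?mulr_ge0 ?(ltW C0)//=.
move=> [k i] _ /=; rewrite (ord1 k).
have -> : (u *m A) 0 i = dotv u (row i A^T).
  by rewrite mxE; apply: eq_bigr => j _; rewrite !mxE.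
apply: le_trans (dotv_le_norm _ _) _.
rewrite mulrAC ler_wpM2r// -[leLHS]addr0 lerD// ler_wpM2l//.
rewrite [leLHS]/Num.Def.normr/= mx_normrE (bigmax_le _ (normr_ge0 _))//=.
move=> [l j] _ /=; rewrite [leRHS]/Num.Def.normr/= mx_normrE !mxE.
have := le_bigmax (0 : R) (fun i => `|A^T i.1 i.2|) (i, j).
by rewrite /= mxE.
Qed.

Lemma continuous_mulmxr (R : realType) m n (A : 'M[R]_(m, n)) :
  continuous (fun u : 'rV[R]_m => u *m A).
Proof.
have [C C0 AC] := mulmx_le_norm A.
move=> x; have xF : Filter (nbhs x) := nbhs_filter x.
apply/cvgrPdist_le => e e0; apply/near_enorm.
exists (e / C) => [|y]; first by rewrite divr_gt0.
rewrite ltr_pdivlMr// enormBC => yx; rewrite -mulmxBl (le_trans (AC _))// mulrC.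
by rewrite ltW// (le_lt_trans _ yx)// ler_wpM2r ?norm_le_enorm// ltW.
Qed.

Lemma continuous_dotvl (R : realType) n (v : 'rV[R]_n) :
  continuous (fun u : 'rV[R]_n => dotv u v).
Proof.
move=> x; have xF : Filter (nbhs x) := nbhs_filter x.
have v0 : 0 < enorm v + 1 by rewrite ltr_wpDl// enorm_ge0.
apply/cvgrPdist_le => e e0; apply/near_enorm.
exists (e / (enorm v + 1)) => [|y]; first by rewrite divr_gt0.
rewrite ltr_pdivlMr// enormBC => yx; rewrite -dotvBl.
rewrite (le_trans (dotv_cauchy _ _))// (le_trans _ (ltW yx))//.
by rewrite ler_wpM2l ?enorm_ge0// lerDl.
Qed.

(** * Differentials *)

(** Trades the little-o condition for an explicit estimate at each [e], the form in which the
    geometric inequalities arrive. *)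
Lemma is_diff_eps (R : realType) (V W : normedModType R) (f df : V -> W) x :
    linear df -> continuous df ->
    (forall e, 0 < e ->
      \forall y \near x, `|f y - f x - df (y - x)| <= e * `|y - x|) ->
  is_diff x f df.
Proof.
move=> ldf cdf fe.
pose l : {linear V -> W} := HB.pack df (GRing.isLinear.Build R V W *:%R df ldf).
have H : f \o shift x = cst (f x) + l +o_ 0 id.
  apply/eqaddoP => e /fe; rewrite (near_shift 0) subr0.
  by apply: filterS => h /=; rewrite addrK opprD addrA.
have U : 'd f x = l :> (V -> W) by exact: diff_unique.
by apply: DiffDef => //; apply/diff_locallyP; rewrite U.
Qed.

Lemma is_diff_epsE (R : realType) (V W : normedModType R) (f df : V -> W) x :
    is_diff x f df -> forall e, 0 < e ->
  \forall y \near x, `|f y - f x - df (y - x)| <= e * `|y - x|.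
Proof.
move=> [/diff_locally H <-] e e0; move/eqaddoP: H => /(_ e e0) fe0.
rewrite (near_shift 0) subr0; move: fe0.
by apply: filterS => h /=; rewrite addrK opprD addrA.
Qed.

Lemma is_diff_linear (R : realType) (V W : normedModType R) (f df : V -> W) x :
  is_diff x f df -> linear df /\ continuous df.
Proof.
move=> [fx <-]; split; first exact: linearP.
exact: diff_continuous.
Qed.

Lemma is_diff_row_eps (R : realType) m n (f : 'rV[R]_m -> 'rV[R]_n) x A :
    (forall e, 0 < e ->
      \forall y \near x, `|f y - f x - (y - x) *m A| <= e * `|y - x|) ->
  is_diff x f (fun u => u *m A).
Proof.
apply: is_diff_eps => [a u v|]; last exact: continuous_mulmxr.
by rewrite mulmxDl scalemxAl.
Qed.

Lemma is_diff_dotv_eps (R : realType) n (f : 'rV[R]_n -> R) x g :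
    (forall e, 0 < e ->
      \forall y \near x, `|f y - f x - dotv (y - x) g| <= e * `|y - x|) ->
  is_diff x f (fun u => dotv u g).
Proof.
apply: is_diff_eps => [a u v|]; last exact: continuous_dotvl.
by rewrite dotvDl dotvZl.
Qed.

Lemma is_diff_mulmxr (R : realType) m n (A : 'M[R]_(m, n)) x :
  is_diff x (fun u : 'rV[R]_m => u *m A) (fun u => u *m A).
Proof.
apply: is_diff_row_eps => e e0; near=> y.
by rewrite -!mulmxBl subrr mul0mx normr0 mulr_ge0// ltW.
Unshelve. all: by end_near. Qed.

Lemma is_diff_dotvl (R : realType) n (g x : 'rV[R]_n) :
  is_diff x (fun u : 'rV[R]_n => dotv u g) (fun u => dotv u g).
Proof.
apply: is_diff_dotv_eps => e e0; near=> y.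
by rewrite -!dotvBl subrr dotv0l normr0 mulr_ge0// ltW.
Unshelve. all: by end_near. Qed.

Lemma is_diff_coord (R : realType) (V : normedModType R) n
    (f df : V -> 'rV[R]_n) x :
  is_diff x f df <-> linear df /\ continuous df /\
    forall i, is_diff x (fun y => f y 0 i) (fun u => df u 0 i).
Proof.
split=> [fx|[ldf [cdf fi]]].
  have [ldf cdf] := is_diff_linear fx.
  split=> //; split=> // i; apply: is_diff_eps => [a u v|u|e e0].
  - by rewrite ldf !mxE.
  - exact: (cvg_comp _ _ (cdf u) (@coord_continuous R 1 n 0 i (df u))).
  - near=> y; apply: le_trans (_ : `|f y - f x - df (y - x)| <= _).
      by have := coord_le_norm (f y - f x - df (y - x)) i; rewrite !mxE.
    by near: y; exact: is_diff_epsE.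
apply: is_diff_eps => // e e0.
have : \forall y \near x, forall i,
    `|f y 0 i - f x 0 i - df (y - x) 0 i| <= e * `|y - x|.
  by apply: filter_forall => i; have := is_diff_epsE (fi i) e0.
apply: filterS => y fy.
rewrite [leLHS]/Num.Def.normr/= mx_normrE bigmax_le ?mulr_ge0 ?(ltW e0)//=.
by move=> [k i] _ /=; rewrite (ord1 k) !mxE fy.
Unshelve. all: by end_near. Qed.

Lemma is_diff_col (R : realType) m n (f : 'rV[R]_m -> 'rV[R]_n) x
    (A : 'M[R]_(m, n)) :
    (forall i, is_diff x (fun y => f y 0 i) (fun u => (u *m A) 0 i)) ->
  is_diff x f (fun u => u *m A).
Proof.
move=> fi; apply/is_diff_coord; split=> [a u v|].
  by rewrite mulmxDl scalemxAl.
by split=> //; exact: continuous_mulmxr.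
Qed.

Lemma is_diff_grad (R : realType) n (f : 'rV[R]_n -> R) x : differentiable f x ->
  is_diff x f (fun u => dotv u (\row_i partial i f x)).
Proof.
move=> fx; apply: DiffDef => //; apply/funext => u.
rewrite [u in LHS]row_sum_delta linear_sum; apply: eq_bigr => i _.
by rewrite linearZ mxE /partial deriveE.
Qed.

Lemma is_diff_jacobian (R : realType) m n (f : 'rV[R]_m -> 'rV[R]_n) x :
  differentiable f x -> is_diff x f (fun u => u *m 'J f x).
Proof.
by move=> fx; apply: DiffDef => //; apply/funext => u; rewrite mul_rV_lin1.
Qed.

Lemma partial_is_diff (R : realType) n (f : 'rV[R]_n -> R) x g i :
  is_diff x f (fun u => dotv u g) -> partial i f x = g 0 i.
Proof. by move=> [fx fd]; rewrite /partial deriveE// fd dotvC dotv_deltar. Qed.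

Lemma is_diff_continuous (R : realType) (V W : normedModType R) (f df : V -> W) x :
  is_diff x f df -> {for x, continuous f}.
Proof. by move=> [fx _]; exact: differentiable_continuous. Qed.

Lemma is_diff_uniq (R : realType) (V W : normedModType R) (f df dg : V -> W) x :
  is_diff x f df -> is_diff x f dg -> df = dg.
Proof. by move=> [_ <-] [_ <-]. Qed.

Lemma is_diff_near_eq (R : realType) (V W : normedModType R) (f g df : V -> W) x :
  {near x, f =1 g} -> is_diff x f df -> is_diff x g df.
Proof.
move=> fg fx; have [ldf cdf] := is_diff_linear fx.
have fgx : f x = g x := nbhs_singleton fg.
apply: is_diff_eps => // e /(is_diff_epsE fx).
by apply: filterS2 fg => y fgy; rewrite fgy fgx.
Qed.

(* No differentiability of the factor [c] is needed where [f] vanishes. *)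
Lemma is_diff_scale0 (R : realType) (V W : normedModType R) (c : V -> R)
    (f df : V -> W) x :
    {for x, continuous c} -> is_diff x f df -> f x = 0 ->
  is_diff x (fun y => c y *: f y) (fun u => c x *: df u).
Proof.
move=> cx fx fx0; have [ldf cdf] := is_diff_linear fx.
apply: is_diff_eps => [a u v|u|e e0].
- by rewrite ldf scalerDr !scalerA mulrC.
- by have := cvgZl_tmp (k := c x) (cdf u); exact.
pose l : {linear V -> W} := HB.pack df (GRing.isLinear.Build R V W *:%R df ldf).
have /linear_lipschitz[k k0 lk] : continuous l by [].
have {}lk z : `|df z| <= k * `|z| := lk z.
have d0 : 0 < e / (2 * k) by rewrite divr_gt0// mulr_gt0.
have cx0 : 0 < `|c x| + 1 by rewrite ltr_wpDl.
near=> y.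
rewrite fx0 scaler0 subr0.
have -> : c y *: f y - c x *: df (y - x) =
    c y *: (f y - f x - df (y - x)) + (c y - c x) *: df (y - x).
  by rewrite fx0 subr0 scalerBr scalerBl addrA subrK.
rewrite (le_trans (ler_normD _ _))// !normrZ (splitr e) mulrDl lerD//.
  apply: (@le_trans _ _ ((`|c x| + 1) * (e / 2 / (`|c x| + 1) * `|y - x|))).
    apply: ler_pM => //.
      rewrite -lerBlDl (le_trans (lerB_dist _ _))//; near: y.
      have /cvgrPdist_le/(_ 1 ltr01) := cx.
      by apply: filterS => y; rewrite distrC.
    near: y; apply: (is_diff_epsE fx).
    by rewrite !divr_gt0.
  by rewrite mulrA mulrCA divff ?mulr1 ?gt_eqF.
apply: (@le_trans _ _ (e / (2 * k) * (k * `|y - x|))).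
  apply: ler_pM => //.
  near: y; have /cvgrPdist_le/(_ _ d0) := cx.
  by apply: filterS => y; rewrite distrC.
by rewrite mulrA invfM mulrA divfK ?gt_eqF.
Unshelve. all: by end_near. Qed.

Lemma is_diff_is_derive (R : realType) (V W : normedModType R)
    (f df : V -> W) x u : is_diff x f df -> is_derive x u f (df u).
Proof.
move=> [fx fd]; apply: DeriveDef; first exact: diff_derivable.
by rewrite deriveE// fd.
Qed.

Lemma is_diff_line (R : realType) (V : normedModType R) (x u : V) (t : R) :
  is_diff t (fun s : R => x + s *: u) (fun s => s *: u).
Proof.
apply: is_diff_eps => [a s r|s|e e0].
- by rewrite scalerDl scalerA.
- exact: scalel_continuous.
- near=> s.
  by rewrite opprD addrACA subrr add0r -scalerBl subrr normr0 mulr_ge0// ltW.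
Unshelve. all: by end_near. Qed.

Lemma is_diff_shift (R : realType) (V W : normedModType R) (f df : V -> W) c x :
  is_diff (x + c) f df -> is_diff x (fun y => f (y + c)) df.
Proof.
move=> fx; have [ldf cdf] := is_diff_linear fx.
apply: is_diff_eps => // e /(is_diff_epsE fx).
rewrite (near_shift x) [x + c - x]addrC addKr.
by apply: filterS => y /=; rewrite opprD addrACA subrr addr0.
Qed.

Lemma is_diff_ext (R : realType) (V W : normedModType R) (f df g dg : V -> W) x :
  is_diff x f df -> f =1 g -> df =1 dg -> is_diff x g dg.
Proof. by move=> fx /funext <- /funext <-. Qed.

Lemma is_derive_line (R : realType) (V W : normedModType R)
    (f df : V -> W) x u (t : R) : is_diff (x + t *: u) f df ->
  is_derive t 1 (fun s : R => f (x + s *: u)) (df u).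
Proof.
move=> fx; have xu := is_diff_line x u t.
have := @is_diff_is_derive R R^o W _ _ t 1 (is_diff_comp xu fx).
by rewrite /= scale1r.
Qed.

(** * Mean value estimates: symmetry of second derivatives and Taylor expansion *)

Lemma MVT_grad (R : realType) n (F : 'rV[R]_n -> R) G :
    (forall x, is_diff x F (fun u => dotv u (G x))) ->
  forall x u, exists t : R,
    [/\ 0 <= t, t <= 1 & F (x + u) - F x = dotv u (G (x + t *: u))].
Proof.
move=> FG x u.
pose g (t : R) := F (x + t *: u).
have gd (t : R) : is_derive t 1 g (dotv u (G (x + t *: u))).
  exact: (is_derive_line (FG (x + t *: u))).
have [|t t01] := @MVT_segment _ g (fun t => dotv u (G (x + t *: u))) 0 1 ler01
  (fun t _ => gd t).
  apply: continuous_subspaceT => t; apply: differentiable_continuous.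
  by apply/derivable1_diffP; have [] := gd t.
rewrite /g scale0r addr0 scale1r subr0 mulr1 => ->.
by exists t; split=> //; move: t01; rewrite in_itv /= => /andP[].
Qed.

(** Apply the mean value theorem to [F (y + t *: v) - F y] along [t *: u], then expand [G] about [x]
    at the two resulting points. Differentiability of [G] at the single point [x] is enough. *)
Lemma second_difference (R : realType) n (F : 'rV[R]_n -> R) G x A :
    (forall y, is_diff y F (fun u => dotv u (G y))) ->
    is_diff x G (fun u => u *m A) ->
  forall u v e, 0 < e -> \forall t \near (0 : R)^'+,
    `|F (x + t *: u + t *: v) - F (x + t *: u) - F (x + t *: v) + F x
      - t ^+ 2 * dotv u (v *m A)| <= e * t ^+ 2.
Proof.
move=> FG GA u v e e0.
(* Each of the two expansion errors is at most [e / M * (t * (|u| + |v|))], and pairing them with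
   [t *: u] costs the factor [n * t * |u|]. *)
pose M := n%:R * `|u| * (2 * (`|u| + `|v|)) + 1.
have M0 : 0 < M by rewrite ltr_wpDl// !mulr_ge0// addr_ge0.
have /nbhs_ballP[d /= d0 Gd] := is_diff_epsE GA (divr_gt0 e0 M0).
have uv0 : 0 < `|u| + `|v| + 1 by rewrite ltr_wpDl// addr_ge0.
near=> t.
have t0 : 0 < t by near: t; exact: nbhs_right_gt.
have rem (h : 'rV[R]_n) : `|h| <= t * (`|u| + `|v|) ->
    `|G (x + h) - G x - h *m A| <= e / M * (t * (`|u| + `|v|)).
  move=> ht; rewrite [x + h]addrC; have := Gd (h + x).
  rewrite -ball_normE /ball_ /= distrC addrK => Gh.
  apply: (le_trans (Gh _)); last by rewrite ler_wpM2l// ltW// divr_gt0.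
  apply: le_lt_trans (le_trans ht _) (_ : t * (`|u| + `|v| + 1) < d).
    by rewrite ler_wpM2l ?(ltW t0)// lerDl.
  rewrite -ltr_pdivlMr//; near: t.
  by apply: nbhs_right_lt; rewrite divr_gt0.
have Hd y : is_diff y (fun y => F (y + t *: v) - F y)
    (fun w => dotv w (G (y + t *: v) - G y)).
  have Fv := is_diff_shift (FG (y + t *: v)).
  by apply: (is_diff_ext (is_diffB Fv (FG y))) => // w /=; rewrite dotvBr.
have [s [s0 s1]] := MVT_grad Hd x (t *: u).
set h1 := s *: (t *: u).
have h1t : `|h1| <= t * (`|u| + `|v|).
  rewrite /h1 !normrZ (ger0_norm s0) (gtr0_norm t0).
  rewrite (@le_trans _ _ (t * `|u|))//.
    by rewrite ler_piMl// mulr_ge0// ltW.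
  by rewrite ler_wpM2l ?(ltW t0)// lerDl.
have h2t : `|h1 + t *: v| <= t * (`|u| + `|v|).
  rewrite (le_trans (ler_normD _ _))// /h1 !normrZ (ger0_norm s0) (gtr0_norm t0).
  by rewrite mulrDr lerD2r ler_piMl// mulr_ge0// ltW.
have := rem _ h2t; have := rem _ h1t; rewrite addrA => r1 r2 E.
rewrite [X in `|X - _|](_ : _ = dotv (t *: u) (G (x + h1 + t *: v) - G (x + h1))); last first.
  by rewrite -E opprB addrA addrAC.
have -> : dotv (t *: u) (G (x + h1 + t *: v) - G (x + h1)) - t ^+ 2 * dotv u (v *m A)
   = dotv (t *: u) ((G (x + h1 + t *: v) - G x - (h1 + t *: v) *m A) -
                    (G (x + h1) - G x - h1 *m A)).
  rewrite mulmxDl -[(t *: v) *m A]scalemxAl; move: (G _) (G _) (G _) => a b c.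
  by rewrite !(dotv_lin, opprD, opprK); ring.
rewrite (le_trans (dotv_le_norm _ _))// normrZ (gtr0_norm t0).
have tu0 : 0 <= n%:R * (t * `|u|) by rewrite !mulr_ge0// ltW.
apply: (le_trans (ler_wpM2l tu0 (le_trans (ler_normB _ _) (lerD r2 r1)))).
have -> : n%:R * (t * `|u|) * (e / M * (t * (`|u| + `|v|)) + e / M * (t * (`|u| + `|v|)))
  = e * t ^+ 2 * ((M - 1) / M) by rewrite /M; field; rewrite gt_eqF.
rewrite ler_piMr ?mulr_ge0 ?sqr_ge0 ?(ltW e0)//.
by rewrite ler_pdivrMr// mul1r gerBl.
Unshelve. all: by end_near. Qed.

(** The second difference is unchanged when [u] and [v] are exchanged, so its two expansions agree
    up to o(t^2). *)
Lemma hessian_sym (R : realType) n (F : 'rV[R]_n -> R) G x A :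
    (forall y, is_diff y F (fun u => dotv u (G y))) ->
    is_diff x G (fun u => u *m A) ->
  A^T = A.
Proof.
move=> FG GA; apply/matrixP => i j; rewrite mxE.
pose u := delta_mx 0 i : 'rV[R]_n; pose v := delta_mx 0 j : 'rV[R]_n.
have -> : A j i = dotv u (v *m A).
  by rewrite dotvC dotv_deltar -rowE mxE.
have -> : A i j = dotv v (u *m A).
  by rewrite dotvC dotv_deltar -rowE mxE.
apply/eqP; rewrite -subr_eq0 -normr_le0; apply/ler_addgt0Pl => e e0; rewrite addr0.
have e20 : 0 < e / 2 by rewrite divr_gt0.
near (0 : R)^'+ => t.
have t0 : 0 < t by near: t; exact: nbhs_right_gt.
have h1 : `|F (x + t *: u + t *: v) - F (x + t *: u) - F (x + t *: v) + F x
      - t ^+ 2 * dotv u (v *m A)| <= e / 2 * t ^+ 2.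
  by near: t; exact: second_difference.
have h2 : `|F (x + t *: v + t *: u) - F (x + t *: v) - F (x + t *: u) + F x
      - t ^+ 2 * dotv v (u *m A)| <= e / 2 * t ^+ 2.
  by near: t; exact: second_difference.
have t2 : 0 < t ^+ 2 by rewrite exprn_gt0.
rewrite -(ler_pM2r t2) -[t ^+ 2 in leLHS](gtr0_norm t2) -normrM.
rewrite [x + _ + _]addrAC in h2.
have := le_trans (ler_normB _ _) (lerD h2 h1).
rewrite -mulrDl -splitr; congr (`|_| <= _).
by ring.
Unshelve. all: by end_near. Qed.

Lemma enorm_segment_lt (R : realType) n (x a b : 'rV[R]_n) (t e : R) :
    0 <= t -> t <= 1 -> enorm (a - x) < e -> enorm (b - x) < e ->
  enorm (a + t *: (b - a) - x) < e.
Proof.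
move=> t0 t1 ax bx.
have -> : a + t *: (b - a) - x = (1 - t) *: (a - x) + t *: (b - x).
  by rewrite !scalerBr !scalerBl !scale1r; apply/rowP => k; rewrite !mxE; ring.
apply: le_lt_trans (enormD _ _) _; rewrite !enormZ.
rewrite (ger0_norm t0) ger0_norm ?subr_ge0//.
have [->|tn0] := eqVneq t 0; first by rewrite subr0 mul1r mul0r addr0.
have tp : 0 < t by rewrite lt0r tn0.
rewrite [ltRHS](_ : e = (1 - t) * e + t * e); last by ring.
by rewrite ler_ltD ?ltr_pM2l// ler_wpM2l ?subr_ge0// ltW.
Qed.

Lemma C1_lipschitz (R : realType) n (f : 'rV[R]_n -> R) x : C1_fun f ->
  exists K e, [/\ 0 <= K, 0 < e & forall a b,
    enorm (a - x) < e -> enorm (b - x) < e -> `|f b - f a| <= K * enorm (b - a)].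
Proof.
move=> [df pf]; pose M i := `|partial i f x| + 1.
have M0 i : 0 < M i by rewrite ltr_wpDl.
have pM i : \forall y \near x, `|partial i f y| <= M i.
  have /cvgrPdist_le/(_ 1 ltr01) := pf i x.
  apply: filterS => y xy; rewrite /M -lerBlDl (le_trans (lerB_dist _ _))//.
  by rewrite distrC.
have /near_enorm[e e0 fe] := filter_forall (nbhs_filter x) pM.
exists (\sum_i M i), e; split=> //; first by apply: sumr_ge0 => i _; rewrite ltW.
move=> a b ax bx.
have [t [t0 t1]] := MVT_grad (fun y => is_diff_grad (df y)) a (b - a).
rewrite [a + (b - a)]addrC subrK => ->.
rewrite (le_trans (ler_norm_sum _ _ _))// mulr_suml ler_sum// => i _.
rewrite normrM mulrC; apply: ler_pM => //; last first.
  exact: le_trans (coord_le_norm _ _) (norm_le_enorm _).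
by rewrite mxE; apply: fe; exact: enorm_segment_lt.
Qed.

Definition grad (R : realType) n (f : 'rV[R]_n -> R) (x : 'rV[R]_n) : 'rV[R]_n :=
  
  \row_i partial i f x.

(** By the mean value theorem the remainder is [b - a] paired with a difference of gradients, and
    each partial derivative is locally Lipschitz. The constants serve all pairs near [x], because
    two moving boundary points will be compared. *)
Lemma C2_taylor (R : realType) n (f : 'rV[R]_n -> R) x : C2_fun f ->
  exists K e, [/\ 0 <= K, 0 < e & forall a b,
    enorm (a - x) < e -> enorm (b - x) < e ->
    `|f b - f a - dotv (b - a) (grad f a)| <= K * enorm (b - a) ^+ 2].
Proof.
move=> [[df _] cf].
have /choice[K /choice[e Ke]] i := C1_lipschitz x (cf i).
have e0 i : 0 < e i by have [] := Ke i.
have K0 i : 0 <= K i by have [] := Ke i.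
pose e' := \big[Num.min/1]_i e i.
have e'0 : 0 < e' by apply: lt_bigmin.
exists (\sum_i K i), e'; split=> //; first exact: sumr_ge0.
move=> a b ax bx.
have [t [t0 t1]] := MVT_grad (fun y => is_diff_grad (df y)) a (b - a).
rewrite [a + (b - a)]addrC subrK -/(grad f _) => ->; rewrite -dotvBr.
rewrite (le_trans (ler_norm_sum _ _ _))// mulr_suml ler_sum// => i _.
have -> : K i * enorm (b - a) ^+ 2 = enorm (b - a) * (K i * enorm (b - a)) by ring.
rewrite normrM; apply: ler_pM => //.
  exact: le_trans (coord_le_norm _ _) (norm_le_enorm _).
have ei : e' <= e i by apply: bigmin_le_cond.
have [_ _ /(_ a (a + t *: (b - a)))] := Ke i.
rewrite !mxE => h; apply: le_trans (h _ _) _.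
- exact: lt_le_trans ax ei.
- by apply: lt_le_trans ei; exact: enorm_segment_lt.
- rewrite ler_wpM2l// addrAC subrr add0r enormZ ger0_norm//.
  by rewrite ler_piMl// enorm_ge0.
Qed.

(** * Local defining functions *)

(* F is the depth below a graph over the hyperplane orthogonal to q, so that
   [x + F x *: q] is the point of {F = 0} above or below x. *)
Record defining_function (R : realType) n (Omega : set 'rV[R]_n)
    (y0 : 'rV[R]_n) (F : 'rV[R]_n -> R) (G : 'rV[R]_n -> 'rV[R]_n)
    (q : 'rV[R]_n) : Prop := DefiningFunction {
  defining_grad : forall x, is_diff x F (fun u => dotv u (G x));
  defining_hess : forall x, differentiable G x;
  defining_taylor : exists K e, [/\ 0 <= K, 0 < e & forall a b,
    enorm (a - y0) < e -> enorm (b - y0) < e ->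
    `|F b - F a - dotv (b - a) (G a)| <= K * enorm (b - a) ^+ 2];
  defining_shift : forall x c, F (x + c *: q) = F x - c;
  defining_near : \forall x \near y0, Omega x <-> F x < 0
}.

(** In the rotated coordinates [q] is the unit height vector and [x *m A] the horizontal part, so
    that [F] is the graph function minus the height. *)
Lemma C2_boundary_defining (R : realType) n (Omega : set 'rV[R]_n.+1) y0 :
    C2_boundary Omega -> bdry Omega y0 ->
  exists F G q, defining_function Omega y0 F G q.
Proof.
move=> C2O /C2O[Q [f [[QQ _] f2 Of]]].
pose A := col' ord_max Q; pose q := (col ord_max Q)^T.
have hA x : col' ord_max (x *m Q) = x *m A.
  by apply/matrixP => i j; rewrite !mxE; apply: eq_bigr => k _; rewrite !mxE.
have hq (x : 'rV[R]_n.+1) : (x *m Q) 0 ord_max = dotv x q.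
  by rewrite mxE; apply: eq_bigr => k _; rewrite !mxE.
have QtQ : Q^T *m Q = 1%:M by apply: mulmx1C.
have qQ : q *m Q = delta_mx 0 ord_max.
  by rewrite /q tr_col -row_mul QtQ row1.
have qq : dotv q q = 1 by rewrite -hq qQ mxE !eqxx.
have qA : q *m A = 0.
  by rewrite -hA qQ; apply/rowP => j; rewrite !mxE [lift _ _ == _]eq_sym (negPf (neq_lift _ _)) andbF.
have [[df _] d2f] := f2.
exists (fun x => f (x *m A) - dotv x q), (fun x => grad f (x *m A) *m A^T - q), q.
split.
- move=> x; have := is_diff_comp (is_diff_mulmxr A x) (is_diff_grad (df (x *m A))).
  move=> /is_diffB/(_ (is_diff_dotvl q x)) h.
  apply: (is_diff_ext h) => // u.
  by rewrite dotvBr -dotv_mulmx.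
- move=> x.
  have gd y : is_diff y (grad f) (fun u => u *m (\matrix_(i, j) partial i (partial j f) y)).
    apply: is_diff_col => i; have [pf _] := d2f i.
    apply: (is_diff_ext (is_diff_grad (pf y))) => u; first by rewrite mxE.
    by rewrite mxE; apply: eq_bigr => j _; rewrite !mxE.
  have := is_diff_comp (is_diff_mulmxr A x) (gd (x *m A)).
  move=> h; have := is_diff_comp h (is_diff_mulmxr A^T _).
  move=> /is_diffB/(_ (is_diff_cst q x)) {}h.
  by have [] := is_diff_ext h (fun _ => erefl) (fun _ => erefl).
- have [K [e [K0 e0 Ke]]] := C2_taylor (y0 *m A) f2.
  have cA := @continuous_mulmxr R n.+1 n A y0.
  have : \forall x \near y0, enorm (x *m A - y0 *m A) < e.
    apply: (cA [set z | enorm (z - y0 *m A) < e]).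
    by apply/near_enorm; exists e.
  move=> /near_enorm[d d0 dA].
  have [C C0 AC] := mulmx_le_norm A.
  (* Going back from [(b - a) *m A] to [b - a] costs [n] for the change of norm and [C] for the
     matrix, and the estimate is quadratic. *)
  exists (K * (n%:R * C) ^+ 2), d; split=> //; first by rewrite mulr_ge0// sqr_ge0.
  move=> a b /dA aA /dA bA; have := Ke _ _ aA bA; rewrite -mulmxBl dotv_mulmx.
  rewrite -mulrA -exprMn => h.
  rewrite [X in `|X|](_ : _ = f (b *m A) - f (a *m A) - dotv (b - a) (grad f (a *m A) *m A^T)); last first.
    by rewrite dotvBr [dotv (b - a) q]dotvBl; ring.
  apply: (le_trans h); rewrite ler_wpM2l// ler_sqr ?nnegrE ?mulr_ge0 ?enorm_ge0 ?(ltW C0)//.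
  rewrite (le_trans (enorm_le_norm _))// -mulrA ler_wpM2l// (le_trans (AC _))//.
  by rewrite ler_wpM2l ?(ltW C0)// norm_le_enorm.
- move=> x c; rewrite mulmxDl -scalemxAl qA scaler0 addr0 dotvDl dotvZl qq.
  by ring.
- by apply: filterS Of => x; rewrite hA hq subr_lt0.
Qed.

Lemma is_derive1_is_diff (R : realType) (V : normedModType R) (g : R -> V) (t : R) w :
  is_derive t (1 : R) g w -> is_diff t g (fun s => s *: w).
Proof.
move=> [gd gw]; have dg : differentiable g t by apply/derivable1_diffP.
by apply: DiffDef => //; apply/funext => s; rewrite deriv1E// derive1E gw.
Qed.

(** Differentiate [F (x + c *: q) = F x - c] in [c]. Hence [G] vanishes nowhere, and the unit normal
    field extends to the whole space; the bound [1 <= enorm q * enorm (G x)] also comes from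
    here. *)
Lemma defining_grad_q (R : realType) n (Omega : set 'rV[R]_n) y0 F G q x :
  defining_function Omega y0 F G q -> dotv q (G x) = -1.
Proof.
move=> [FG _ _ Fq _].
have h := FG (x + 0 *: q).
have := is_derive_line h.
under eq_fun do rewrite Fq.
rewrite scale0r addr0 => -[_ <-].
by rewrite derive_val add0r mul1r.
Qed.

Lemma defining_grad_gt0 (R : realType) n (Omega : set 'rV[R]_n) y0 F G q x :
  defining_function Omega y0 F G q -> 0 < enorm (G x).
Proof.
move=> /(defining_grad_q x) Gq; rewrite enorm_gt0; apply/eqP => G0.
by move: Gq => /eqP; rewrite G0 dotv0r eq_sym oppr_eq0 oner_eq0.
Qed.

Lemma defining_continuous (R : realType) n (Omega : set 'rV[R]_n) y0 F G q :
  defining_function Omega y0 F G q -> continuous F.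
Proof. by move=> [FG _ _ _ _] x; exact: is_diff_continuous (FG x). Qed.

(** Each condition is either global or holds on a ball about [y0], hence on smaller balls about
    nearby points. It lets the same [F], [G], [q] follow the foot of a moving point. *)
Lemma defining_recenter (R : realType) n (Omega : set 'rV[R]_n) y0 F G q :
    defining_function Omega y0 F G q ->
  \forall z \near y0, defining_function Omega z F G q.
Proof.
move=> [FG dG [K [e [K0 e0 Ke]]] Fq /near_enorm[d d0 Od]].
apply/near_enorm; exists (Num.min e d / 2) => [|z].
  by rewrite divr_gt0// lt_min e0.
set r := Num.min e d / 2 => zr.
have near_z a : enorm (a - z) < r -> enorm (a - y0) < Num.min e d.
  move=> az; apply: le_lt_trans (enorm_triangle _ z _) _.
  by rewrite (splitr (Num.min e d)) ltrD.
have r0 : 0 < r by rewrite divr_gt0// lt_min e0.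
split=> //.
- exists K, r; split=> // a b /near_z + /near_z.
  by rewrite !lt_min => /andP[ae _] /andP[be _]; exact: Ke.
- apply/near_enorm; exists r => // a /near_z; rewrite lt_min => /andP[_ ad].
  exact: Od.
Qed.

Lemma closure_defining (R : realType) n (Omega : set 'rV[R]_n) y0 F G q :
  defining_function Omega y0 F G q -> closure Omega y0 <-> F y0 <= 0.
Proof.
move=> dF; have [_ _ _ Fq nF] := dF.
split=> [cl|F0 B By0].
  rewrite leNgt; apply/negP => F0.
  have [z [Oz [Oz' Fz]]] : Omega `&` [set z | (Omega z <-> F z < 0) /\ 0 < F z] !=set0.
    apply: cl; apply: filterI => //.
    have yF : Filter (nbhs y0) := nbhs_filter y0.
  have cF : continuous F := defining_continuous dF.
  by have := cvgr_gt _ (cF y0) _ F0; exact.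
  by have := Oz'.1 Oz; rewrite ltNge (ltW Fz).
have [e e0 eP] := (near_enorm y0 _).1 (filterI nF By0).
(* Small enough that [y0 + c *: q] stays in the ball of radius [e]; there [F] equals
   [F y0 - c < 0]. *)
pose c := e / (2 * (enorm q + 1)).
have q0 : 0 < enorm q + 1 by rewrite ltr_wpDl// enorm_ge0.
have c0 : 0 < c by rewrite divr_gt0// mulr_gt0.
have [|Oc Bc] := eP (y0 + c *: q).
  rewrite addrAC subrr add0r enormZ gtr0_norm//.
  rewrite (@lt_le_trans _ _ (c * (enorm q + 1)))//.
    by rewrite ltr_pM2l// ltrDl.
  rewrite /c invfM mulrA divfK ?gt_eqF//.
  by rewrite ler_pdivrMr// ler_peMr ?ltW// ltr1n.
exists (y0 + c *: q); split => //; apply/Oc; rewrite Fq subr_lt0.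
exact: le_lt_trans F0 c0.
Qed.

Lemma bdry_defining (R : realType) n (Omega : set 'rV[R]_n) y0 F G q :
  open Omega -> defining_function Omega y0 F G q -> bdry Omega y0 <-> F y0 = 0.
Proof.
move=> oO dF; rewrite /bdry (interior_id _).1//.
have Oy : Omega y0 <-> F y0 < 0 := nbhs_singleton (defining_near dF).
have := closure_defining dF; split=> [[/H F0 nO]|F0].
  by apply/eqP; rewrite eq_le F0 leNgt; apply/negP => /Oy.
by split; [apply/H; rewrite F0|move/Oy; rewrite F0 ltxx].
Qed.

(** The line through [y] with direction [w], pushed along [q] into the set where [F] vanishes:
    [defining_shift] makes [F] zero along it. It supplies boundary curves with any prescribed
    tangent velocity. *)
Definition graph_curve (R : realType) n (F : 'rV[R]_n -> R) (y q w : 'rV[R]_n)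
  (t : R) : 'rV[R]_n := y + t *: w + F (y + t *: w) *: q.

Lemma graph_curve0 (R : realType) n (F : 'rV[R]_n -> R) (y q w : 'rV[R]_n) :
  F y = 0 -> graph_curve F y q w 0 = y.
Proof. by move=> Fy; rewrite /graph_curve scale0r addr0 Fy scale0r addr0. Qed.

Lemma graph_curve_is_diff (R : realType) n (F : 'rV[R]_n -> R) G
    (y q w : 'rV[R]_n) (t : R) : (forall x, is_diff x F (fun u => dotv u (G x))) ->
  is_diff t (graph_curve F y q w)
    (fun s => s *: (w + dotv w (G (y + t *: w)) *: q)).
Proof.
move=> FG; have l := is_diff_line y w t.
have Fl := is_diff_comp l (FG (y + t *: w)).
have h := is_diffD l (is_diff_comp Fl (is_diff_scalel (F (y + t *: w)) q)).
apply: (is_diff_ext h) => // s.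
by rewrite scalerDr scalerA /= -dotvZl.
Qed.

Lemma defining_curve (R : realType) n (Omega : set 'rV[R]_n) y0 F G q w t :
  defining_function Omega y0 F G q -> F (graph_curve F y0 q w t) = 0.
Proof. by move=> [_ _ _ Fq _]; rewrite /graph_curve Fq subrr. Qed.

Lemma near_graph_curve_bdry (R : realType) n (Omega : set 'rV[R]_n) y0 F G q w :
    open Omega -> defining_function Omega y0 F G q -> F y0 = 0 ->
  \forall t \near 0, bdry Omega (graph_curve F y0 q w t).
Proof.
move=> oO dF F0.
have rg : \forall t \near 0, defining_function Omega (graph_curve F y0 q w t) F G q.
  have cg := is_diff_continuous (graph_curve_is_diff y0 q w 0 (defining_grad dF)).
  have := cg [set z | defining_function Omega z F G q].
  by rewrite graph_curve0// => /(_ (defining_recenter dF)).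
by apply: filterS rg => t /(bdry_defining oO) ->; exact: (defining_curve _ _ dF).
Qed.

(** Along a curve in the boundary [F] is zero near time 0, so its velocity is orthogonal to [G y0].
    Conversely the velocity of [graph_curve] at 0 is exactly [w] once [dotv w (G y0)] vanishes. *)
Lemma tangent_defining (R : realType) n (Omega : set 'rV[R]_n) y0 F G q w :
    open Omega -> defining_function Omega y0 F G q -> F y0 = 0 ->
  tangent_vector (bdry Omega) y0 w <-> dotv w (G y0) = 0.
Proof.
move=> oO dF F0; have FG := defining_grad dF; have rF := defining_recenter dF.
split=> [[g [g0 gb gw]]|w0].
  have dg := is_derive1_is_diff gw.
  have cg : {for 0, continuous g} := is_diff_continuous dg.
  have Fg : \forall t \near 0, F (g t) = 0.
    have := cg [set z | defining_function Omega z F G q].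
    rewrite g0 => /(_ rF); apply: filterS2 gb => t gb rg.
    exact: (bdry_defining oO rg).1.
  have [_ d1] := is_diff_is_derive (1 : R) (is_diff_comp dg (FG (g 0))).
  have [_ d2] : is_derive (0 : R) (1 : R) (F \o g) 0.
    apply: (near_eq_is_derive _ (is_derive_cst (0 : R) (0 : R) (1 : R))).
    by apply: filterS Fg => t /= ->.
  by rewrite -d2 d1 /= scale1r g0.
exists (graph_curve F y0 q w); split; first exact: graph_curve0.
- exact: (near_graph_curve_bdry w oO dF F0).
- have := is_diff_is_derive (1 : R) (graph_curve_is_diff y0 q w 0 FG).
  by rewrite scale0r addr0 w0 scale0r addr0 scale1r.
Qed.

Definition unormal (R : realType) n (G : 'rV[R]_n -> 'rV[R]_n) (x : 'rV[R]_n) :=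
  (enorm (G x))^-1 *: G x.

Section UnitNormal.
Context (R : realType) (n : nat) (Omega : set 'rV[R]_n) (y0 : 'rV[R]_n).
Context (F : 'rV[R]_n -> R) (G : 'rV[R]_n -> 'rV[R]_n) (q : 'rV[R]_n).
Hypothesis dF : defining_function Omega y0 F G q.

Lemma enorm_unormal x : enorm (unormal G x) = 1.
Proof.
have G0 := defining_grad_gt0 x dF.
by rewrite /unormal enormZ gtr0_norm ?invr_gt0// mulVf ?gt_eqF.
Qed.

Lemma dotv_unormal x : dotv (unormal G x) (unormal G x) = 1.
Proof. by rewrite -sqr_enorm enorm_unormal expr1n. Qed.

Lemma unormal_grad x : G x = enorm (G x) *: unormal G x.
Proof.
have G0 := defining_grad_gt0 x dF.
by rewrite /unormal scalerA mulfV ?gt_eqF// scale1r.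
Qed.

Lemma dotv_unormal_eq0 x w : (dotv w (unormal G x) = 0) <-> (dotv w (G x) = 0).
Proof.
split=> [h|h]; first by rewrite unormal_grad dotvZr h mulr0.
by rewrite /unormal dotvZr h mulr0.
Qed.

(** To first order [F] changes by plus or minus [t * enorm (G y0)] along the normal, and for
    [t < enorm (G y0) / (K + 1)] this beats the Taylor remainder [K * t ^+ 2]. *)
Lemma defining_sign : F y0 = 0 -> exists2 e, 0 < e & forall t, 0 < t -> t < e ->
  F (y0 - t *: unormal G y0) < 0 /\ 0 < F (y0 + t *: unormal G y0).
Proof.
move=> F0; have [K [e [K0 e0 Ke]]] := defining_taylor dF.
have G0 := defining_grad_gt0 y0 dF.
have K1 : 0 < K + 1 by rewrite ltr_wpDl.
exists (Num.min e (enorm (G y0) / (K + 1))) => [|t t0].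
  by rewrite lt_min e0 divr_gt0.
rewrite lt_min => /andP[te]; rewrite ltr_pdivlMr// => tK.
have tKG : K * t ^+ 2 < t * enorm (G y0).
  rewrite expr2 mulrA [K * t]mulrC [ltLHS]mulrC ltr_pM2l//.
  by apply: le_lt_trans tK; rewrite ler_wpM2l ?(ltW t0)// lerDl.
have NG : dotv (unormal G y0) (G y0) = enorm (G y0).
  by rewrite [G y0 in X in dotv _ X]unormal_grad dotvZr dotv_unormal mulr1.
have tay s : `|s| = t -> `|F (y0 + s *: unormal G y0) - s * enorm (G y0)| <= K * t ^+ 2.
  move=> st; have := Ke y0 (y0 + s *: unormal G y0).
  rewrite subrr enorm0 addrAC subrr add0r enormZ enorm_unormal mulr1 st F0 subr0.
  by rewrite dotvZl NG; apply.
split.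
  have := tay (- t); rewrite normrN gtr0_norm// scaleNr => /(_ erefl).
  by rewrite ler_norml => /andP[_]; move: (F _) tKG; move: (K * _) => *; lra.
have := tay t; rewrite gtr0_norm// => /(_ erefl).
by rewrite ler_norml => /andP[+ _]; move: (F _) tKG; move: (K * _) => *; lra.
Qed.

Lemma outward_unormal : open Omega -> F y0 = 0 ->
  outward_unit_normal Omega y0 (unormal G y0).
Proof.
move=> oO F0; split; first exact: enorm_unormal.
  by move=> w /(tangent_defining _ oO dF F0)/dotv_unormal_eq0.
have [e e0 He] := defining_sign F0.
have [d d0 Hd] := (near_enorm y0 _).1 (defining_recenter dF).
near=> t.
have t0 : 0 < t by near: t; exact: nbhs_right_gt.
have te : t < e by near: t; exact: nbhs_right_lt.
have td : t < d by near: t; exact: nbhs_right_lt.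
have [F1 F2] := He _ t0 te.
have h1 : defining_function Omega (y0 - t *: unormal G y0) F G q.
  apply: Hd; rewrite addrAC subrr add0r enormN enormZ enorm_unormal mulr1.
  by rewrite gtr0_norm.
have h2 : defining_function Omega (y0 + t *: unormal G y0) F G q.
  apply: Hd; rewrite addrAC subrr add0r enormZ enorm_unormal mulr1.
  by rewrite gtr0_norm.
split; first exact/(nbhs_singleton (defining_near h1)).
by move=> /(closure_defining h2); rewrite leNgt F2.
Unshelve. all: by end_near. Qed.
End UnitNormal.

(** The component of [v] orthogonal to [N] is orthogonal both to [v] and to [N], hence to itself. *)
Lemma orth_colinear (R : realType) n (N v : 'rV[R]_n) : dotv N N = 1 ->
  (forall w, dotv w N = 0 -> dotv w v = 0) -> v = dotv v N *: N.
Proof.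
move=> NN h; apply/eqP; rewrite -subr_eq0 -dotv_eq0; apply/eqP.
have wN : dotv (v - dotv v N *: N) N = 0 by rewrite dotvBl dotvZl NN mulr1 subrr.
by rewrite [LHS]dotvBr (h _ wN) dotvZr wN mulr0 subrr.
Qed.

(** Orthogonality to the tangent space leaves only two unit vectors, and the side condition excludes
    the inner one: it would place points [y0 + t *: unormal G y0] in [Omega]. *)
Lemma outward_unit_normalE (R : realType) n (Omega : set 'rV[R]_n) y0 F G q v :
    open Omega -> defining_function Omega y0 F G q -> F y0 = 0 ->
  outward_unit_normal Omega y0 v <-> v = unormal G y0.
Proof.
move=> oO dF F0; split=> [[v1 vT vO]|->]; last exact: (outward_unormal dF).
have NN := dotv_unormal dF y0.
have vN : v = dotv v (unormal G y0) *: unormal G y0.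
  apply: orth_colinear NN _ => w /(dotv_unormal_eq0 dF) w0.
  by apply/vT/(tangent_defining _ oO dF F0).
have : enorm v = 1 by [].
rewrite {1}vN enormZ (enorm_unormal dF) mulr1 => /eqP.
rewrite eqr_norml ler01 andbT => /orP[/eqP c1|/eqP c1]; rewrite c1 in vN.
  by rewrite vN scale1r.
rewrite scaleN1r in vN.
have [_ _ NO] := outward_unormal dF oO F0.
have [t [[Ot _] [_ Nt]]] := filter_ex (filterI vO NO).
by case: Nt; apply: subset_closure; move: Ot; rewrite vN scalerN opprK.
Qed.

(** * Nearest points and the good set *)

Lemma continuous_edist (R : realType) n (x : 'rV[R]_n) :
  continuous (fun z : 'rV[R]_n => enorm (z - x)).
Proof.
move=> z; have zF : Filter (nbhs z) := nbhs_filter z.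
apply/cvgrPdist_le => e e0; apply/near_enorm; exists e => // y yz.
rewrite (le_trans (enorm_sub_dist _ _))// opprB addrA subrK enormBC.
exact: ltW.
Qed.

Lemma compact_edist_le (R : realType) n (A : set 'rV[R]_n) x r :
  closed A -> compact (A `&` [set z | enorm (z - x) <= r]).
Proof.
move=> cA; apply: bounded_closed_compact.
  exists (r + `|x|); split; first exact: num_real.
  move=> M rM z [_ zx]; apply: le_trans (ltW rM).
  rewrite -lerBlDr (le_trans _ zx)// (le_trans _ (norm_le_enorm _))//.
  exact: lerB_dist.
apply: closedI => //.
have cx : continuous (fun z : 'rV[R]_n => enorm (z - x)) := @continuous_edist R n x.
exact: (@preimage_closed _ _ _ [set t | t <= r] (fun z _ => cx z) (@closed_le R r)).
Qed.

Lemma nearest_exists (R : realType) n (A : set 'rV[R]_n) x :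
  closed A -> A !=set0 -> exists y, nearest_point A x y.
Proof.
move=> cA [a Aa].
have K := compact_edist_le (x := x) (r := enorm (a - x)) cA.
have cx : continuous (fun z : 'rV[R]_n => enorm (z - x)) := @continuous_edist R n x.
have [|c] := EVT_min_rV _ K (continuous_subspaceT cx); first by exists a; split=> /=.
rewrite inE => -[Ac ca] cmin; exists c; split=> // z Az.
rewrite !(enormBC x); have [za|/ltW az] := leP (enorm (z - x)) (enorm (a - x)).
  by have := cmin z; rewrite inE; apply; split.
exact: le_trans ca az.
Qed.

Lemma closed_bdry (R : realType) n (Omega : set 'rV[R]_n) : closed (bdry Omega).
Proof.
apply: closedI; first exact: closed_closure.
by apply: open_closedC; exact: open_interior.
Qed.

Lemma bdry_notin (R : realType) n (Omega : set 'rV[R]_n) y :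
  open Omega -> bdry Omega y -> ~ Omega y.
Proof. by move=> oO; rewrite /bdry (interior_id _).1// => -[]. Qed.

(** Points of the segment from [y] towards [x] are closer to [x] than [y], so they lie in [Omega]
    and accumulate at [y]. This reconciles [dist_bdry], taken over the complement, with nearest
    points, taken on the boundary. *)
Lemma nearest_complement_bdry (R : realType) n (Omega : set 'rV[R]_n) x y :
  open Omega -> Omega x -> nearest_point (~` Omega) x y -> bdry Omega y.
Proof.
move=> oO Ox [Oy ymin]; rewrite /bdry (interior_id _).1//; split=> //.
move=> B /near_enorm[e e0 eB].
have xy : 0 < enorm (x - y).
  by rewrite enorm_gt0 subr_eq0; apply/eqP => xy; apply: Oy; rewrite -xy.
pose t := Num.min 1 (e / (2 * enorm (x - y))).
have t0 : 0 < t by rewrite lt_min ltr01 divr_gt0// mulr_gt0.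
have t1 : t <= 1 by rewrite ge_min lexx.
exists (y + t *: (x - y)); split.
  apply/not_notP => /ymin; rewrite opprD addrA -{2}[x - y]scale1r -scalerBl enormZ.
  rewrite ger0_norm ?subr_ge0// leNgt; apply/negP; rewrite negbK.
  by rewrite gtr_pMl// gtrBl.
apply: eB; rewrite addrAC subrr add0r enormZ gtr0_norm//.
rewrite -ltr_pdivlMr// /t gt_min; apply/orP; right.
by rewrite ltr_pM2l// ltf_pV2 ?posrE ?mulr_gt0// ltr_pMl// ltr1n.
Qed.

Lemma nearest_bdry_le (R : realType) n (Omega : set 'rV[R]_n) x y z :
    open Omega -> Omega x -> nearest_point (bdry Omega) x y -> ~ Omega z ->
  enorm (x - y) <= enorm (x - z).
Proof.
move=> oO Ox [_ ymin] Oz.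
have [p px] : exists p, nearest_point (~` Omega) x p.
  by apply: nearest_exists; [exact: open_closedC|exists z].
have bp := nearest_complement_bdry oO Ox px.
exact: le_trans (ymin _ bp) (px.2 _ Oz).
Qed.

Lemma dist_bdryE (R : realType) n (Omega : set 'rV[R]_n) x y :
    open Omega -> Omega x -> nearest_point (bdry Omega) x y ->
  dist_bdry Omega x = enorm (x - y).
Proof.
move=> oO Ox xy; have Oy : ~ Omega y := bdry_notin oO xy.1.
apply/eqP; rewrite eq_le; apply/andP; split.
  apply: ge_inf; last by exists y.
  by exists 0 => _ [z _ <-]; exact: enorm_ge0.
apply: lb_le_inf; first by exists (enorm (x - y)), y.
by move=> _ [z Oz <-]; exact: (nearest_bdry_le oO Ox xy).
Qed.

Lemma nearest_gt0 (R : realType) n (Omega : set 'rV[R]_n) x y :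
  open Omega -> Omega x -> bdry Omega y -> 0 < enorm (x - y).
Proof.
move=> oO Ox /(bdry_notin oO) Oy; rewrite enorm_gt0 subr_eq0.
by apply/eqP => xy; apply: Oy; rewrite -xy.
Qed.

Lemma is_diff_sqr (R : realType) n (a : 'rV[R]_n) :
  is_diff a (fun z => dotv z z) (fun u => dotv u (2 *: a)).
Proof.
apply: is_diff_dotv_eps => e e0.
have n1 : 0 < n%:R + 1 :> R by rewrite ltr_wpDl.
apply/near_enorm; exists (e / (n%:R + 1)) => [|z za]; first by rewrite divr_gt0.
have {}za := le_lt_trans (norm_le_enorm _) za.
have -> : dotv z z - dotv a a - dotv (z - a) (2 *: a) = dotv (z - a) (z - a).
  by rewrite dotvBB dotvZr dotvBl; ring.
apply: le_trans (dotv_le_norm _ _) _; rewrite ler_wpM2r//.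
rewrite ltr_pdivlMr// mulrC in za; apply: le_trans (ltW za).
by rewrite ler_wpM2r// lerDl.
Qed.

Lemma is_diff_sqr_comp (R : realType) (V : normedModType R) n
    (f df : V -> 'rV[R]_n) x : is_diff x f df ->
  is_diff x (fun y => dotv (f y) (f y)) (fun u => 2 * dotv (df u) (f x)).
Proof.
move=> fx; apply: (is_diff_ext (is_diff_comp fx (is_diff_sqr (f x)))) => // u.
by rewrite /= dotvZr.
Qed.

Lemma is_diff_subr (R : realType) (V W : normedModType R) (f df : V -> W) c x :
  is_diff x f df -> is_diff x (fun y => f y - c) df.
Proof.
move=> fx; apply: (is_diff_ext (is_diffB fx (is_diff_cst c x))) => // u.
exact: subr0.
Qed.

Lemma near_ball0 (R : realType) (P : set R) : (\forall t \near 0, P t) ->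
  exists2 e, 0 < e & forall t, `|t| < e -> P t.
Proof.
move=> /nbhs_ballP[e /= e0 eP]; exists e => // t te; apply: eP.
by rewrite -ball_normE /ball_ /= sub0r normrN.
Qed.

Section Nearest.
Context (R : realType) (n : nat) (Omega : set 'rV[R]_n).
Hypothesis oO : open Omega.

(** Along each curve [graph_curve F y q w] with [w] tangent, the squared distance to [x] is minimal
    at time 0; its derivative there shows that [y - x] is orthogonal to the tangent space, hence
    normal. *)
Lemma nearest_unormal F G q x y : Omega x ->
    nearest_point (bdry Omega) x y -> defining_function Omega y F G q ->
  x = y - enorm (x - y) *: unormal G y.
Proof.
move=> Ox xy dF.
have F0 : F y = 0 := (bdry_defining oO dF).1 xy.1.
have NN := dotv_unormal dF y.
have yxN : y - x = dotv (y - x) (unormal G y) *: unormal G y.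
  apply: orth_colinear NN _ => w /(dotv_unormal_eq0 dF) w0.
  pose g := graph_curve F y q w.
  have dg t := graph_curve_is_diff y q w t (defining_grad dF).
  have dh t := is_diff_is_derive (1 : R) (is_diff_sqr_comp (is_diff_subr x (dg t))).
  have [e e0 be] := near_ball0 (near_graph_curve_bdry w oO dF F0).
  have ddh t : t \in `]- e, e[ ->
      derivable (fun s : R => dotv (graph_curve F y q w s - x) (graph_curve F y q w s - x)) t 1.
    by move=> _; have [] := dh t.
  have [||t|_] := derive1_at_min (a := - e) (b := e) (c := 0) _ ddh.
  - by rewrite ge0_cp// ltW.
  - by rewrite in_itv /= oppr_lt0 e0.
  - rewrite in_itv /= -ltr_norml => te.
    rewrite -!enorm_le_sqr ![enorm (_ - x)]enormBC [graph_curve _ _ _ _ 0]graph_curve0//.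
    by apply: xy.2; exact: be.
  have [_ ->] := dh 0; rewrite scale0r addr0 w0 scale0r addr0 scale1r.
  by rewrite graph_curve0// => /eqP; rewrite mulf_eq0 pnatr_eq0 => /eqP.
set c := dotv _ _ in yxN.
have xyc : enorm (x - y) = `|c| by rewrite enormBC yxN enormZ (enorm_unormal dF) mulr1.
have r0 := nearest_gt0 oO Ox xy.1.
have [c0|c0] := ltP c 0; last first.
  by rewrite xyc ger0_norm// -yxN opprB addrC subrK.
(* If [c < 0], then [x] lies on the outer normal ray, and [y + t *: unormal G y] with small [t] is
   outside [Omega] yet closer to [x] than [y]. *)
exfalso; have [e e0 He] := defining_sign dF F0.
have [d d0 Hd] := (near_enorm y _).1 (defining_near dF).
pose t := Num.min (Num.min e d) (- c) / 2.
have t0 : 0 < t by rewrite divr_gt0// !lt_min e0 d0 oppr_gt0.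
have [te td tc] : [/\ t < e, t < d & t < - c].
  have : t < Num.min (Num.min e d) (- c).
    by rewrite ltr_pdivrMr// ltr_pMr ?ltr1n// !lt_min e0 d0 oppr_gt0.
  by rewrite !lt_min => /andP[/andP[-> ->] ->].
have [_ Ft] := He _ t0 te.
have td' : enorm (y + t *: unormal G y - y) < d.
  by rewrite addrAC subrr add0r enormZ (enorm_unormal dF) mulr1 gtr0_norm.
have nO : ~ Omega (y + t *: unormal G y).
  by move/(Hd _ td').1; rewrite ltNge (ltW Ft).
have := nearest_bdry_le oO Ox xy nO; apply/negP; rewrite -ltNge.
have xy' : x - y = (- c) *: unormal G y by rewrite scaleNr -yxN opprB.
rewrite opprD addrA xyc xy' -scalerBl enormZ (enorm_unormal dF) mulr1.
by rewrite [`|c|]ltr0_norm// ger0_norm ?subr_ge0 ?(ltW tc)// ltrBlDr ltrDl.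
Qed.
End Nearest.

(** Points of [A] at distance at least [e] from [y0] have a positive excess distance from [x0],
    attained by compactness at some [c]. A nearest point of [x] is within [r + 2 * enorm (x - x0)]
    of [x0], so [d] is half that excess. Uniqueness is assumed at [x0] alone. *)
Lemma nearest_continuous (R : realType) n (A : set 'rV[R]_n) x0 y0 e :
    closed A -> nearest_point A x0 y0 ->
    (forall y, nearest_point A x0 y -> y = y0) -> 0 < e ->
  exists2 d, 0 < d & forall x y, enorm (x - x0) < d -> nearest_point A x y ->
    enorm (y - y0) < e.
Proof.
move=> cA xy0 y0u e0; set r := enorm (x0 - y0).
pose B := A `&` [set z | e <= enorm (z - y0)].
have cB : closed B.
  apply: closedI => //.
  have cy : continuous (fun z : 'rV[R]_n => enorm (z - y0)) := @continuous_edist R n y0.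
  exact: (@preimage_closed _ _ _ [set t | e <= t] (fun z _ => cy z) (@closed_ge R e)).
have close x y : nearest_point A x y -> enorm (y - x0) <= r + 2 * enorm (x - x0).
  move=> xy; apply: le_trans (enorm_triangle _ x _) _.
  have := xy.2 _ xy0.1; rewrite [enorm (y - x)]enormBC => h.
  have := enorm_triangle x x0 y0; rewrite -/r; move: h.
  move: (enorm _) (enorm _) (enorm _) => a b c; lra.
have [B0|/set0P/negP/negPn/eqP B0] := pselect (B !=set0); last first.
  exists 1 => // x y _ xy; rewrite ltNge; apply/negP => ey.
  have : B y by split=> //; exact: xy.1.
  by rewrite B0.
have [c [[Ac ec] cmin]] := nearest_exists x0 cB B0.
have rc : r < enorm (x0 - c).
  rewrite ltNge; apply/negP => cr; have : c = y0.
    by apply: y0u; split=> // z /xy0.2; exact: le_trans.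
  by move=> cy; move: ec; rewrite /= cy subrr enorm0 leNgt e0.
exists ((enorm (x0 - c) - r) / 2) => [|x y xd xy].
  by rewrite divr_gt0// subr_gt0.
rewrite ltNge; apply/negP => ey.
have := cmin y (conj xy.1 ey); have := close _ _ xy.
rewrite [enorm (y - x0)]enormBC.
move: (enorm (x0 - y)) (enorm (x0 - c)) (enorm (x - x0)) xd rc => a b f; lra.
Qed.

(** Write [g z - g x] as the difference of the squares times the inverse of [g z + g x]: the first
    factor vanishes at [x], and the second need only be continuous. *)
Lemma is_diff_of_sqr (R : realType) (V : normedModType R) (g dg : V -> R) x :
    {for x, continuous g} -> (\forall z \near x, 0 < g z) ->
    is_diff x (fun z => g z ^+ 2 - g x ^+ 2) dg ->
  is_diff x g (fun u => (2 * g x)^-1 * dg u).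
Proof.
move=> gc gn sq; have r0 : 0 < g x := nbhs_singleton gn.
have [r rE] : exists r, g x = r by exists (g x).
have gc' : g z @[z --> x] --> r by rewrite -rE.
rewrite rE in r0 sq *.
have rr : r + r != 0 by rewrite gt_eqF// addr_gt0.
have cd : {for x, continuous (fun z => (g z + r)^-1)}.
  by rewrite /prop_for /continuous_at rE; exact: (cvgV rr (cvgD gc' (cvg_cst r))).
have sq0 : g x ^+ 2 - r ^+ 2 = 0 by rewrite rE subrr.
have h := is_diff_scale0 cd sq sq0.
have h2 : is_diff x (fun z => g z - r) (fun u => (2 * r)^-1 * dg u).
  apply: is_diff_near_eq (is_diff_ext h (fun=> erefl) _) => [|u].
    near=> z; have dz : 0 < g z by near: z.
    by rewrite subr_sqr [_ *: _]mulrC mulfK// lt0r_neq0// addr_gt0.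
  by rewrite rE mulr_natl mulr2n.
apply: (is_diff_ext (is_diff_subr (- r) h2)) => // z.
by rewrite opprK subrK.
Unshelve. all: by end_near. Qed.

(** * Nearest points on the good set and the gradient of the distance *)

Definition proj_bdry (R : realType) n (Omega : set 'rV[R]_n) (x : 'rV[R]_n) :=
  xget x [set y | nearest_point (bdry Omega) x y].

Section Good.
Context (R : realType) (n : nat) (Omega : set 'rV[R]_n).
Hypothesis oO : open Omega.

Lemma good_near x : good_set Omega x -> \forall z \near x, good_set Omega z.
Proof.
move=> [U [oU UO Uu] Ux]; apply: filterS (open_nbhs_nbhs (conj oU Ux)) => z Uz.
by exists U.
Qed.

Lemma good_sub x : good_set Omega x -> Omega x.
Proof. by move=> [U [oU UO Uu] /UO]. Qed.

Lemma proj_nearest x : good_set Omega x ->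
  nearest_point (bdry Omega) x (proj_bdry Omega x).
Proof.
move=> [U [oU UO Uu] /Uu[y [xy _]]].
exact: (xgetPex x (ex_intro (fun y => nearest_point (bdry Omega) x y) y xy)).
Qed.

Lemma proj_uniq x y : good_set Omega x -> nearest_point (bdry Omega) x y ->
  y = proj_bdry Omega x.
Proof.
move=> gx xy; have gx' := gx; have [U [oU UO Uu] /Uu[z [_ zu]]] := gx'.
by rewrite -(zu _ xy) -(zu _ (proj_nearest gx)).
Qed.

Lemma proj_bdry_continuous x : good_set Omega x -> {for x, continuous (proj_bdry Omega)}.
Proof.
move=> gx; have xF : Filter (nbhs x) := nbhs_filter x.
apply/cvgrPdist_le => e e0.
have [d d0 dP] := nearest_continuous (@closed_bdry R n Omega) (proj_nearest gx)
  (fun y => proj_uniq gx) e0.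
have gn := good_near gx.
have dn : \forall z \near x, enorm (z - x) < d by apply/near_enorm; exists d.
near=> z; rewrite distrC (le_trans (norm_le_enorm _))// ltW//.
by apply: (dP z); [near: z|apply: proj_nearest; near: z].
Unshelve. all: by end_near. Qed.

Lemma dist_proj x : good_set Omega x ->
  dist_bdry Omega x = enorm (x - proj_bdry Omega x).
Proof. by move=> gx; exact: (dist_bdryE oO (good_sub gx) (proj_nearest gx)). Qed.

Lemma dist_gt0 x : good_set Omega x -> 0 < dist_bdry Omega x.
Proof.
move=> gx; rewrite dist_proj//.
exact: nearest_gt0 oO (good_sub gx) (proj_nearest gx).1.
Qed.

Lemma dist_good_continuous x : good_set Omega x ->
  {for x, continuous (dist_bdry Omega)}.
Proof.
move=> gx; have xF : Filter (nbhs x) := nbhs_filter x.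
apply/cvgrPdist_le => e e0; have gn := good_near gx.
have zx : \forall z \near x, enorm (z - x) < e by apply/near_enorm; exists e.
near=> z; have gz : good_set Omega z by near: z.
have zxe : enorm (z - x) < e by near: z.
rewrite !dist_proj//.
move: (proj_nearest gx) (proj_nearest gz).
move: (proj_bdry Omega x) (proj_bdry Omega z) => y w xy zw.
have h1 := xy.2 _ zw.1; have h2 := zw.2 _ xy.1.
have h3 := enorm_triangle x z w; have h4 := enorm_triangle z x y.
rewrite [enorm (x - z)]enormBC in h3; rewrite ler_norml.
move: (enorm (x - y)) (enorm (x - w)) (enorm (z - w)) (enorm (z - y)) (enorm (z - x))
  h1 h2 h3 h4 zxe => a b c d f *.
by apply/andP; split; lra.
Unshelve. all: by end_near. Qed.

(** With feet [y] of [x] and [w] of [z], comparing each point with the foot of the other squeezes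
    the increment. The error is at most [enorm (z - x) ^+ 2 + 2 * (enorm (z - x) * enorm (w - y))],
    which is o(|z - x|) because the projection is continuous. *)
Lemma is_diff_sqr_dist x : good_set Omega x ->
  is_diff x (fun z => dist_bdry Omega z ^+ 2 - dist_bdry Omega x ^+ 2)
    (fun u => dotv u (2 *: (x - proj_bdry Omega x))).
Proof.
move=> gx; apply: is_diff_dotv_eps => e e0.
pose M : R := n%:R + 1.
have M0 : 0 < M by rewrite /M ltr_wpDl.
(* The two error terms contribute one and two shares of [e / (3 * M)], and [M] pays for the passage
   to the sup norm. *)
have e'0 : 0 < e / (3 * M) by rewrite divr_gt0// mulr_gt0.
have [d d0 dP] := nearest_continuous (@closed_bdry R n Omega) (proj_nearest gx)
  (fun y => proj_uniq gx) e'0.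
have [d2 d20 gd] := (near_enorm x _).1 (good_near gx).
apply/near_enorm; exists (Num.min (e / (3 * M)) (Num.min d d2)) => [|z].
  by rewrite !lt_min e'0 d0.
rewrite !lt_min => /and3P[ze zd zd2]; have gz := gd _ zd2.
have {dP} yz := dP _ _ zd (proj_nearest gz).
rewrite subrr subr0 !dist_proj//.
have {d d0 zd d2 d20 gd zd2} [xy zw] := (proj_nearest gx, proj_nearest gz).
move: (proj_bdry Omega x) (proj_bdry Omega z) => y w in xy zw yz *.
have h2 : dotv (z - w) (z - w) <= dotv (z - y) (z - y).
  by rewrite -enorm_le_sqr; exact: zw.2 _ xy.1.
have h1 : dotv (x - y) (x - y) <= dotv (x - w) (x - w).
  by rewrite -enorm_le_sqr; exact: xy.2 _ zw.1.
rewrite !sqr_enorm.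
have bnd : `|dotv (z - w) (z - w) - dotv (x - y) (x - y) - dotv (z - x) (2 *: (x - y))|
    <= enorm (z - x) ^+ 2 + 2 * (enorm (z - x) * enorm (w - y)).
  have := dotv_cauchy (z - x) (w - y); rewrite sqr_enorm.
  move: h1 h2.
  have -> : z - w = (z - x) + ((x - y) - (w - y)) by rewrite opprB !addrA !subrK.
  have -> : z - y = (z - x) + (x - y) by rewrite addrA subrK.
  have -> : x - w = (x - y) - (w - y) by rewrite opprB addrA subrK.
  move: (z - x) (x - y) (w - y) => a b c.
  rewrite !dotv_lin [dotv b a]dotvC [dotv c a]dotvC [dotv c b]dotvC !ler_norml.
  have := dotv_ge0 a; move: (enorm a * enorm c) => p.
  move: (dotv a a) (dotv a b) (dotv a c) (dotv b b) (dotv b c) (dotv c c).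
  move=> aa ab ac bb bc cc a0 h1 h2 /andP[h3 h4]; apply/andP; split; lra.
apply: (le_trans bnd).
rewrite (_ : _ + _ = enorm (z - x) * (enorm (z - x) + 2 * enorm (w - y))); last by ring.
apply: (@le_trans _ _ (M * `|z - x| * (e / (3 * M) + 2 * (e / (3 * M))))).
  apply: ler_pM; rewrite ?enorm_ge0//.
  - by rewrite addr_ge0 ?mulr_ge0 ?enorm_ge0.
  - by apply: (le_trans (enorm_le_norm _)); rewrite ler_wpM2r// lerDl.
  - by rewrite lerD ?(ltW ze)// ler_wpM2l// ltW.
by rewrite le_eqVlt; apply/orP; left; apply/eqP; field; rewrite gt_eqF.
Qed.

Lemma is_diff_dist x : good_set Omega x ->
  is_diff x (dist_bdry Omega) (fun u => dotv u
    ((dist_bdry Omega x)^-1 *: (x - proj_bdry Omega x))).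
Proof.
move=> gx; have r0 := dist_gt0 gx.
have := is_diff_of_sqr (dist_good_continuous gx) _ (is_diff_sqr_dist gx).
have /filterS : good_set Omega `<=` [set z | 0 < dist_bdry Omega z].
  by move=> z; exact: dist_gt0.
move=> /(_ (nbhs x) _ (good_near gx)) h /(_ h){}h.
apply: (is_diff_ext h) => // u; rewrite !dotvZr mulrA; congr (_ * _).
by field; rewrite gt_eqF.
Qed.
End Good.

(** * Larger touching balls at the foot of a good point *)

Section Extend.
Context (R : realType) (n : nat) (Omega : set 'rV[R]_n).
Hypothesis oO : open Omega.

(* The gradient of the distance has norm 1, so the distance minus a cone of
   slope less than 1 has no maximum inside a ball of good points. *)
Lemma dist_increase x0 s eta : 0 < eta -> eta < 1 -> 0 < s ->
    (forall z, enorm (z - x0) <= s -> good_set Omega z) ->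
  exists2 z, enorm (z - x0) <= s &
    dist_bdry Omega x0 + (1 - eta) * s <= dist_bdry Omega z.
Proof.
move=> eta0 eta1 s0 good.
pose phi z := dist_bdry Omega z - (1 - eta) * enorm (z - x0).
have K := compact_edist_le (x := x0) (r := s) (@closedT _).
have cphi : {in [set: 'rV[R]_n] `&` [set z | enorm (z - x0) <= s], continuous phi}.
  move=> z; rewrite inE => -[_ /good gz].
  have zF : Filter (nbhs z) := nbhs_filter z.
  apply: (@cvgB _ _ _ _ zF); first exact: dist_good_continuous oO _ gz.
  apply: (@cvgM _ _ _ zF); first exact: cvg_cst.
  exact: continuous_edist.
have [|z] := EVT_max_rV _ K (continuous_in_subspaceT cphi).
  by exists x0; split=> //=; rewrite subrr enorm0 ltW.
rewrite inE => -[_ zs] zmax; exists z => //.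
have max w : enorm (w - x0) <= s -> phi w <= phi z.
  by move=> ws; apply: zmax; rewrite inE.
have := max x0; rewrite subrr enorm0 => /(_ (ltW s0)).
rewrite /phi subrr enorm0 mulr0 subr0 => h0.
have [zs'|sz] := ltP (enorm (z - x0)) s; last first.
  by move: zs sz h0; rewrite /=; move: (dist_bdry _ _) (dist_bdry _ _) (enorm _) => *; nra.
exfalso.
have gz := good _ zs; have r0 := dist_gt0 oO gz.
have dz := is_diff_dist oO gz.
pose nu := (dist_bdry Omega z)^-1 *: (z - proj_bdry Omega z).
have nu1 : enorm nu = 1.
  rewrite /nu enormZ -dist_proj// gtr0_norm ?invr_gt0// mulVf// gt_eqF//.
have [d d0 dP] : exists2 d, 0 < d & forall w, enorm (w - z) < d ->
    `|dist_bdry Omega w - dist_bdry Omega z - dotv (w - z) nu| <= eta / 2 * `|w - z|.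
  have e0 : 0 < eta / 2 by rewrite divr_gt0.
  exact: (near_enorm z _).1 (is_diff_epsE dz e0).
(* Moving by [t *: nu] raises the distance by at least [(1 - eta / 2) * t] and the cone by at most
   [(1 - eta) * t], against maximality at [z]. *)
pose t := Num.min d (s - enorm (z - x0)) / 2.
have t0 : 0 < t by rewrite divr_gt0// lt_min d0 subr_gt0.
have [td ts] : t < d /\ t < s - enorm (z - x0).
  have : t < Num.min d (s - enorm (z - x0)).
    by rewrite ltr_pdivrMr// ltr_pMr ?ltr1n// lt_min d0 subr_gt0.
  by rewrite lt_min => /andP[].
have wz : z + t *: nu - z = t *: nu by rewrite addrAC subrr add0r.
have etn : enorm (t *: nu) = t by rewrite enormZ nu1 mulr1 gtr0_norm.
have wx : enorm (z + t *: nu - x0) <= enorm (z - x0) + t.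
  by rewrite addrAC -{2}etn enormD.
have := dP (z + t *: nu); rewrite wz etn => /(_ td).
have nn : dotv nu nu = 1 by rewrite -sqr_enorm nu1 expr1n.
have tn : `|t *: nu| <= t by rewrite -{2}etn norm_le_enorm.
rewrite dotvZl nn mulr1 ler_norml => /andP[h1 _].
have h2 : enorm (z + t *: nu - x0) <= s.
  by apply: (le_trans wx); rewrite -lerBrDl ltW.
have := max _ h2; rewrite /phi.
move: wx h1; have : 0 < eta by []. have : eta < 1 by []. move: t0 tn.
move: (dist_bdry Omega (z + t *: nu)) (dist_bdry Omega z) => a b.
move: (enorm (z + t *: nu - x0)) (enorm (z - x0)) `|t *: nu| => p q r.
clear; move=> t0 tn eta1 eta0 wx h1 h2.
have e1 : eta / 2 * r <= eta / 2 * t by rewrite ler_wpM2l// divr_ge0// ltW.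
have e2 : (1 - eta) * p <= (1 - eta) * (q + t) by rewrite ler_wpM2l// subr_ge0 ltW.
have e3 : 0 < eta * t by rewrite mulr_gt0.
rewrite mulrDr in e2.
have e4 : eta / 2 * t = eta * t / 2 by ring.
rewrite [(1 - eta) * t]mulrBl mul1r in e2.
move: ((1 - eta) * p) ((1 - eta) * q) (eta * t) (eta / 2 * r) (eta / 2 * t) e1 e2 e3 e4 h1 h2.
by move=> u v w u' v' *; lra.
Qed.

(** Take [x1] maximizing the distance on a small closed ball of radius [s] about [x0]. Letting [eta]
    tend to 0 in [dist_increase] gives a gain of at least [s]; the triangle inequality through [x0]
    then forces [enorm (x1 - proj_bdry Omega x0) = dist_bdry Omega x1], so the foot of [x0] is also
    nearest to [x1]. *)
Lemma good_extend x0 : good_set Omega x0 -> exists s x1,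
  [/\ dist_bdry Omega x0 < s, Omega x1,
      nearest_point (bdry Omega) x1 (proj_bdry Omega x0) &
      enorm (x1 - proj_bdry Omega x0) = s].
Proof.
move=> g0; have [e e0 eP] := (near_enorm x0 _).1 (good_near g0).
have s0 : 0 < e / 2 by rewrite divr_gt0.
set s := e / 2 in s0.
have good z : enorm (z - x0) <= s -> good_set Omega z.
  by move=> zs; apply: eP; apply: le_lt_trans zs _; rewrite ltr_pdivrMr// ltr_pMr ?ltr1n.
have K := compact_edist_le (x := x0) (r := s) (@closedT _).
have cd : {in [set: 'rV[R]_n] `&` [set z | enorm (z - x0) <= s],
    continuous (dist_bdry Omega)}.
  by move=> z; rewrite inE => -[_ /good gz]; exact: dist_good_continuous.
have [|x1] := EVT_max_rV _ K (continuous_in_subspaceT cd).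
  by exists x0; split=> //=; rewrite subrr enorm0 ltW.
rewrite inE => -[_ /= x1s] x1max.
have max w : enorm (w - x0) <= s -> dist_bdry Omega w <= dist_bdry Omega x1.
  by move=> ws; apply: x1max; rewrite inE.
have dx1 : dist_bdry Omega x0 + s <= dist_bdry Omega x1.
  apply/ler_addgt0Pr => eps eps0.
  pose eta := Num.min (1 / 2) (eps / s).
  have eta0 : 0 < eta by rewrite lt_min !divr_gt0.
  have eta1 : eta < 1 by rewrite gt_min ltr_pdivrMr// mul1r ltr1n.
  have [z zs] := dist_increase eta0 eta1 s0 good.
  have es : eta * s <= eps by rewrite -ler_pdivlMr// ge_min lexx orbT.
  move=> h; have := max _ zs; move: h.
  move: (dist_bdry _ _) (dist_bdry _ _) (dist_bdry _ _) => a b c.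
  by rewrite mulrBl mul1r; move: (eta * s) es => *; lra.
have g1 := good _ x1s.
have px1 := proj_nearest g1; have px0 := proj_nearest g0.
have d1 := dist_proj oO g1; have d0 := dist_proj oO g0.
have tri := enorm_triangle x1 x0 (proj_bdry Omega x0).
have min1 := px1.2 _ px0.1.
have E : enorm (x1 - proj_bdry Omega x0) = dist_bdry Omega x1.
  apply: le_anti; apply/andP; split; last by rewrite d1; exact: min1.
  apply: le_trans tri (le_trans _ dx1); rewrite d0 addrC lerD2l; exact: x1s.
have r0s : dist_bdry Omega x0 < dist_bdry Omega x1.
  by apply: lt_le_trans dx1; rewrite ltrDl.
exists (dist_bdry Omega x1), x1; split; [exact: r0s|exact: good_sub g1| |exact: E].
split; first exact: px0.1.
by move=> z bz; rewrite E d1; exact: px1.2.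
Qed.
End Extend.

(** * The shape operator *)

Lemma is_diff_sum (R : realType) (V W : normedModType R) m
    (f df : 'I_m -> V -> W) x : (forall i, is_diff x (f i) (df i)) ->
  is_diff x (fun y => \sum_i f i y) (fun u => \sum_i df i u).
Proof.
elim: m f df => [|m IH] f df fd.
  apply: (is_diff_ext (is_diff_cst 0 x)) => y; rewrite big_ord0 //.
apply: (is_diff_ext (is_diffD (fd ord0) (IH _ _ (fun i => fd (lift ord0 i))))) => y;
  by rewrite big_ord_recl.
Qed.

(** The scalar product form of [is_diff_scale0], for a curve velocity [c] that is only
    continuous. *)
Lemma is_diff_dotv0 (R : realType) (V : normedModType R) n
    (c f df : V -> 'rV[R]_n) x :
    {for x, continuous c} -> is_diff x f df -> f x = 0 ->
  is_diff x (fun y => dotv (c y) (f y)) (fun u => dotv (c x) (df u)).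
Proof.
move=> cx /is_diff_coord[_ [_ fx]] fx0; apply: is_diff_sum => i.
have ci : {for x, continuous (fun y => c y 0 i)}.
  exact: (cvg_comp _ _ cx (@coord_continuous R 1 n 0 i (c x))).
by apply: (is_diff_scale0 ci (fx i)); rewrite fx0 mxE.
Qed.

Lemma is_diff_enorm (R : realType) (V : normedModType R) n
    (f df : V -> 'rV[R]_n) x : is_diff x f df -> f x != 0 ->
  is_diff x (fun y => enorm (f y)) (fun u => (enorm (f x))^-1 * dotv (df u) (f x)).
Proof.
move=> fx fx0; have cf := is_diff_continuous fx.
have ec : {for x, continuous (fun y => enorm (f y))}.
  exact: (cvg_comp _ _ cf (@continuous_enorm R n (f x))).
have e0 : 0 < enorm (f x) by rewrite enorm_gt0.
have en : \forall z \near x, 0 < enorm (f z) by exact: (cvgr_gt _ ec _ e0).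
have sq : is_diff x (fun z => enorm (f z) ^+ 2 - enorm (f x) ^+ 2)
    (fun u => 2 * dotv (df u) (f x)).
  apply: (is_diff_ext (is_diff_subr _ (is_diff_sqr_comp fx))) => // z.
  by rewrite sqr_enorm.
apply: (is_diff_ext (is_diff_of_sqr ec en sq)) => // u.
by field; rewrite gt_eqF.
Qed.

Definition tangent_proj (R : realType) n (N : 'rV[R]_n) : 'M[R]_n :=
  1%:M - N^T *m N.

Lemma mul_tangent_proj (R : realType) n (N v : 'rV[R]_n) :
  v *m tangent_proj N = v - dotv v N *: N.
Proof.
by rewrite /tangent_proj mulmxBr mulmx1 mulmxA [v *m _]mx11_scalar -dotvE mul_scalar_mx.
Qed.

(** The quotient rule for [G / |G|]: projecting removes the normal component, that is, the variation
    of the norm. It acts on the whole space and is in general not symmetric; only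
    [tangent_proj N *m L] is, by [shape_sym]. *)
Definition shape_operator (R : realType) n (G : 'rV[R]_n -> 'rV[R]_n)
    (y : 'rV[R]_n) : 'M[R]_n :=
  (enorm (G y))^-1 *: ('J G y *m tangent_proj (unormal G y)).

Section Shape.
Context (R : realType) (n : nat) (Omega : set 'rV[R]_n) (y : 'rV[R]_n).
Context (F : 'rV[R]_n -> R) (G : 'rV[R]_n -> 'rV[R]_n) (q : 'rV[R]_n).
Hypothesis dF : defining_function Omega y F G q.
Let N := unormal G y.
Let L := shape_operator G y.

(** [unormal G z - N] is [G z - enorm (G z) *: N], which vanishes at [y], divided by [enorm (G z)],
    so continuity of the divisor suffices. *)
Lemma is_diff_unormal : is_diff y (unormal G) (fun u => u *m L).
Proof.
have G0 := defining_grad_gt0 y dF.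
have dG := is_diff_jacobian (defining_hess dF y).
have Gn0 : G y != 0 by rewrite -enorm_gt0.
have de := is_diff_enorm dG Gn0.
have c0 : {for y, continuous (fun z => (enorm (G z))^-1)}.
  exact: (cvgV (lt0r_neq0 G0) (is_diff_continuous de)).
have deN := is_diff_comp de (is_diff_scalel (enorm (G y)) N).
have h0 := is_diffB dG deN.
have e0 : G y - enorm (G y) *: N = 0 by rewrite -(unormal_grad dF) subrr.
have h1 := is_diff_scale0 c0 h0 e0.
have h2 : is_diff y (fun z => unormal G z - N) (fun u => u *m L).
  apply: (is_diff_ext h1) => z /=; last first.
    rewrite /L /shape_operator -scalemxAr mulmxA mul_tangent_proj -/N.
    congr (_ *: _); congr (_ - _); congr (_ *: _).
    by rewrite /N /unormal dotvZr.
  have Gz := defining_grad_gt0 z dF.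
  change ((enorm (G z))^-1 *: (G z - enorm (G z) *: N) = unormal G z - N).
  by rewrite scalerBr scalerA mulVf ?gt_eqF// scale1r.
by apply: (is_diff_ext (is_diff_subr (- N) h2)) => // z; rewrite opprK subrK.
Qed.

Lemma unormal_mxV : N *m N^T = 1%:M.
Proof. by rewrite [LHS]mx11_scalar -dotvE (dotv_unormal dF). Qed.

Lemma tangent_proj_idem : tangent_proj N *m tangent_proj N = tangent_proj N.
Proof.
rewrite {1}/tangent_proj mulmxBl mul1mx -mulmxA mulmxBr mulmx1 [N *m (_ *m _)]mulmxA.
by rewrite unormal_mxV mul1mx subrr mulmx0 subr0.
Qed.

Lemma tangent_proj_tr : (tangent_proj N)^T = tangent_proj N.
Proof. by rewrite /tangent_proj linearB /= trmx1 trmx_mul trmxK. Qed.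

Lemma tangent_proj_normal : tangent_proj N *m N^T = 0.
Proof. by rewrite mulmxBl mul1mx -mulmxA unormal_mxV mulmx1 subrr. Qed.

Lemma shape_proj : L *m tangent_proj N = L.
Proof. by rewrite /L -scalemxAl -mulmxA tangent_proj_idem. Qed.

Lemma shape_normal : L *m N^T = 0.
Proof. by rewrite -shape_proj -mulmxA tangent_proj_normal mulmx0. Qed.

Lemma shape_sym : (tangent_proj N *m L)^T = tangent_proj N *m L.
Proof.
have sJ : ('J G y)^T = 'J G y.
  exact: hessian_sym (defining_grad dF) (is_diff_jacobian (defining_hess dF y)).
rewrite /L /shape_operator -scalemxAr linearZ /= !trmx_mul tangent_proj_tr sJ.
by rewrite mulmxA.
Qed.

Lemma mxtrace_shape : \tr (tangent_proj N *m L) = \tr L.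
Proof. by rewrite mxtrace_mulC shape_proj. Qed.

(* Along a curve in the boundary, the derivative of the squared distance to the
   centre [x] is [2 t (1 - s / r) |u|^2 + o(t)], whereas [y] is nearest to [x]. *)
Lemma touching_ball_injective (x u : 'rV[R]_n) (r : R) : open Omega -> Omega x ->
    nearest_point (bdry Omega) x y -> 0 < r -> r < enorm (x - y) ->
  u = r *: (u *m L) -> u = 0.
Proof.
move=> oO Ox xy r0 rs uL; set s := enorm (x - y) in rs.
have F0 : F y = 0 := (bdry_defining oO dF).1 xy.1.
have xE := nearest_unormal oO Ox xy dF; rewrite -/s -/N in xE.
have uN : dotv u N = 0 by rewrite uL dotvZl dotvE -mulmxA shape_normal mulmx0 mxE mulr0.
have uG : dotv u (G y) = 0 by exact: (dotv_unormal_eq0 dF _ _).1.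
apply/eqP/negPn/negP => un0.
have uu0 : 0 < dotv u u by rewrite lt0r dotv_eq0 un0 dotv_ge0.
pose g := graph_curve F y q u.
pose g' t := u + dotv u (G (y + t *: u)) *: q.
have dg t : is_diff t g (fun k => k *: g' t).
  exact: graph_curve_is_diff (defining_grad dF).
have g0 : g 0 = y by exact: graph_curve0.
have g'0 : g' 0 = u by rewrite /g' scale0r addr0 uG scale0r addr0.
(* [F] is identically zero along [g], so the velocity is tangent at every time. *)
have gtan t : dotv (g' t) (unormal G (g t)) = 0.
  apply/(dotv_unormal_eq0 dF).
  have d1 := is_diff_comp (dg t) (defining_grad dF (g t)).
  have d2 : is_diff t (F \o g) 0.
    apply: (is_diff_ext (is_diff_cst 0 t)) => // k.
    by rewrite /= (defining_curve _ _ dF).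
  have := congr1 (fun f => f (1 : R)) (is_diff_uniq d1 d2).
  by rewrite /= scale1r.
(* [g t - x = k t + s *: unormal G (g t)], and the last term is orthogonal to the velocity; half the
   derivative of the squared distance is therefore [dotv (g' t) (k t)], where [k 0 = 0] and [g']
   need only be continuous. *)
pose k t := (g t - y) - s *: (unormal G (g t) - N).
have dk : is_diff 0 k (fun t => t *: ((1 - s / r) *: u)).
  have dg0 := dg 0; rewrite g'0 in dg0.
  have dN : is_diff (g 0) (unormal G) (fun v => v *m L).
    by rewrite g0; exact: is_diff_unormal.
  have dNg := is_diffZ s (is_diff_subr N (is_diff_comp dg0 dN)).
  apply: (is_diff_ext (is_diffB (is_diff_subr y dg0) dNg)) => // t.
  change (t *: u - s *: ((t *: u) *m L) = t *: ((1 - s / r) *: u)).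
  have uL' : u *m L = r^-1 *: u by rewrite {2}uL scalerA mulVf ?gt_eqF// scale1r.
  by rewrite -scalemxAl uL' !scalerA -scalerBl; congr (_ *: _); ring.
have k0 : k 0 = 0 by rewrite /k g0 !subrr scaler0 subr0.
have cg' : {for 0, continuous g'}.
  have dl := is_diff_line y u 0.
  have dG := is_diff_jacobian (defining_hess dF (y + 0 *: u)).
  have d1 := is_diff_comp (is_diff_comp dl dG) (is_diff_dotvl u _).
  have c1 := is_diff_continuous (is_diff_comp d1 (is_diff_scalel _ q)).
  have -> : g' = (fun t => u + dotv (G (y + t *: u)) u *: q).
    by apply/funext => t; rewrite /g' dotvC.
  exact: (cvgD (cvg_cst u) c1).
have dphi := is_diff_dotv0 cg' dk k0; rewrite g'0 in dphi.
(* The slope at 0 of [dotv (g' t) (k t)] is [- c]; an error of at most [c / 2 * t] preserves the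
   negative sign. *)
pose c := (s / r - 1) * dotv u u.
have c0 : 0 < c by rewrite mulr_gt0// subr_gt0 ltr_pdivlMr// mul1r.
have [e e0 phie] := near_ball0 (is_diff_epsE dphi (divr_gt0 c0 (ltr0Sn R 1))).
have phi_lt0 t : 0 < t -> t < e -> dotv (g' t) (k t) < 0.
  move=> t0 te; have := phie t; rewrite k0 dotv0r !subr0 [`|t|]gtr0_norm//.
  move=> /(_ te); rewrite !dotvZr ler_norml => /andP[_].
  have -> : t * ((1 - s / r) * dotv u u) = - (t * c) by rewrite /c; ring.
  have tc : 0 < t * c by rewrite mulr_gt0.
  have -> : c / 2 * t = t * c / 2 by ring.
  by move: (dotv _ _) (t * c) tc => a b; lra.
have [e2 e20 be] := near_ball0 (near_graph_curve_bdry u oO dF F0).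
pose t1 := Num.min e e2 / 2.
have t10 : 0 < t1 by rewrite divr_gt0// lt_min e0.
have [t1e t1e2] : t1 < e /\ t1 < e2.
  have : t1 < Num.min e e2 by rewrite ltr_pdivrMr// ltr_pMr ?ltr1n// lt_min e0.
  by rewrite lt_min => /andP[].
pose h t := dotv (g t - x) (g t - x).
have dh t : is_derive t (1 : R) h (2 * dotv (g' t) (k t)).
  have := is_diff_is_derive (1 : R) (is_diff_sqr_comp (is_diff_subr x (dg t))).
  rewrite scale1r; have -> : g t - x = k t + s *: unormal G (g t).
    rewrite {1}xE /k scalerBr; apply/rowP => i; rewrite !mxE; ring.
  by rewrite dotvDr dotvZr gtan mulr0 addr0.
have [|t] := MVT t10 (fun t _ => dh t).
  apply: continuous_subspaceT => t; apply: differentiable_continuous.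
  by apply/derivable1_diffP; have [] := dh t.
rewrite in_itv /= subr0 => /andP[t0 tt1] hE.
have : h 0 <= h t1.
  rewrite /h -!enorm_le_sqr g0 ![enorm (_ - x)]enormBC; apply: xy.2.
  by apply: be; rewrite gtr0_norm.
rewrite -subr_ge0 hE pmulr_lge0// pmulr_rge0// leNgt phi_lt0//.
exact: lt_trans t1e.
Qed.
End Shape.

(** * The Laplacian of the distance *)

(** After composition with [invmx M] the outer map has identity differential, so its increments
    control those of [Y]: continuity of [Y] first upgrades to a Lipschitz bound at [x], and this
    turns the remaining errors into o(|z - x|). *)
Lemma is_diff_local_inverse (R : realType) m n (W : 'rV[R]_n -> 'rV[R]_n)
    (Y : 'rV[R]_m -> 'rV[R]_n) x (M : 'M[R]_n) (B : 'M[R]_(m, n)) :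
    M \in unitmx -> {for x, continuous Y} -> is_diff (Y x) W (fun v => v *m M) ->
    is_diff x (W \o Y) (fun u => u *m B) ->
  is_diff x Y (fun u => u *m (B *m invmx M)).
Proof.
move=> Mu cY dW dWY; apply: is_diff_row_eps => e e0.
pose W' y := W y *m invmx M; pose B' := B *m invmx M.
have dW' : is_diff (Y x) W' id.
  apply: (is_diff_ext (is_diff_comp dW (is_diff_mulmxr (invmx M) _))) => // v /=.
  by rewrite mulmxK.
have dWY' : is_diff x (W' \o Y) (fun u => u *m B').
  apply: (is_diff_ext (is_diff_comp dWY (is_diff_mulmxr (invmx M) _))) => // v /=.
  by rewrite -mulmxA.
have [C C0 BC] := mulmx_le_norm B'.
(* The bound [1 / 2] lets the increment of [Y] be absorbed, giving at most [2 * (C + 1) * |z - x|];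
   the total error is then at most [e' * (2 * C + 3) * |z - x|]. *)
pose e' := Num.min (1 / 2) (e / (2 * C + 3)).
have C3 : 0 < 2 * C + 3 by rewrite addr_gt0// mulr_gt0.
have e'0 : 0 < e' by rewrite lt_min !divr_gt0.
have e'2 : e' <= 1 / 2 by rewrite ge_min lexx.
have e'e : e' * (2 * C + 3) <= e by rewrite -ler_pdivlMr// ge_min lexx orbT.
have xF : Filter (nbhs x) := nbhs_filter x.
have near1 : \forall z \near x, `|W' (Y z) - W' (Y x) - (Y z - Y x)| <= e' * `|Y z - Y x|.
  exact: (cY _ (is_diff_epsE dW' e'0)).
have near2 := is_diff_epsE dWY' e'0.
near=> z.
have h1 : `|W' (Y z) - W' (Y x) - (Y z - Y x)| <= e' * `|Y z - Y x| by near: z.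
have h2 : `|W' (Y z) - W' (Y x) - (z - x) *m B'| <= e' * `|z - x| by near: z.
have h3 := BC (z - x); have z0 := normr_ge0 (z - x).
have y0 := normr_ge0 (Y z - Y x).
rewrite -/B'; move: h1 h2 h3 z0 y0.
move: (W' (Y z) - W' (Y x)) ((z - x) *m B') (Y z - Y x) `|z - x| => w b y p h1 h2 h3 p0 y0.
have t1 : `|y| <= `|w - y| + `|w - b| + `|b|.
  have -> : y = - (w - y) + (w - b) + b.
    by rewrite opprB addrA [y - w + w]subrK subrK.
  rewrite (le_trans (ler_normD _ _))// lerD2r (le_trans (ler_normD _ _))//.
  by rewrite normrN opprB addrA [_ - w + w]subrK subrK.
have t2 : `|y - b| <= `|w - y| + `|w - b|.
  have -> : y - b = - (w - y) + (w - b) by rewrite opprB addrA subrK.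
  by rewrite (le_trans (ler_normD _ _))// normrN.
move: t1 t2 h1 h2 h3 y0; move: `|w - y| `|w - b| `|b| `|y| `|y - b| => a1 a2 a3 a4 a5.
move=> t1 t2 h1 h2 h3 y0.
have k1 : e' * a4 <= 1 / 2 * a4 by rewrite ler_wpM2r.
have k2 : e' * p <= 1 / 2 * p by rewrite ler_wpM2r.
have k3 : a4 <= 2 * (C * p + p) by lra.
have k4 : e' * a4 <= e' * (2 * (C * p + p)) by rewrite ler_wpM2l// ltW.
have k5 : e' * (2 * C + 3) * p <= e * p by rewrite ler_wpM2r.
have k6 : e' * (2 * C + 3) * p = e' * (2 * (C * p + p)) + e' * p by ring.
by rewrite k6 in k5; lra.
Unshelve. all: by end_near. Qed.

Section ProjDiff.
Context (R : realType) (n : nat) (Omega : set 'rV[R]_n).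
Hypothesis oO : open Omega.
Context (x0 : 'rV[R]_n).
Hypothesis gx0 : good_set Omega x0.
Let y0 := proj_bdry Omega x0.
Let r := dist_bdry Omega x0.
Context (F : 'rV[R]_n -> R) (G : 'rV[R]_n -> 'rV[R]_n) (q : 'rV[R]_n).
Hypothesis dF : defining_function Omega y0 F G q.
Let N := unormal G y0.
Let L := shape_operator G y0.

Definition dproj (s : R) (N : 'rV[R]_n) (L : 'M[R]_n) : 'M[R]_n :=
  tangent_proj N *m invmx (1%:M - s *: L).

Lemma focal_unit : 1%:M - r *: L \in unitmx.
Proof.
have [s [x1 [rs Ox1 x1y x1s]]] := good_extend oO gx0.
have r0 : 0 < r := dist_gt0 oO gx0.
rewrite -row_free_unit -kermx_eq0; apply/eqP/row_matrixP => i; rewrite row0.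
have : row i (kermx (1%:M - r *: L)) *m (1%:M - r *: L) = 0.
  by rewrite -row_mul mulmx_ker row0.
move: (row i _) => u; rewrite mulmxBr mulmx1 -scalemxAr => /subr0_eq uL.
apply: (touching_ball_injective dF oO Ox1 x1y r0 _ uL).
by rewrite [enorm _]x1s.
Qed.

Lemma near_proj_unormal : \forall z \near x0, 
  z = proj_bdry Omega z - dist_bdry Omega z *: unormal G (proj_bdry Omega z).
Proof.
have xF : Filter (nbhs x0) := nbhs_filter x0.
have gn := good_near gx0.
have dn : \forall z \near x0, defining_function Omega (proj_bdry Omega z) F G q.
  have cY : {for x0, continuous (proj_bdry Omega)}  :=
  proj_bdry_continuous gx0.
  exact: (cY _ (defining_recenter dF)).
near=> z.
have gz : good_set Omega z by near: z.
have dz : defining_function Omega (proj_bdry Omega z) F G q by near: z.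
rewrite (dist_proj oO gz).
exact: (nearest_unormal oO (good_sub gz) (proj_nearest gz) dz).
Unshelve. all: by end_near. Qed.

(** Freezing the distance at [r] in [W] gives [W (y z) - y0 = (z - x0) + (delta z - r) *: N (y z)]
    with y the projection and delta the distance. The scalar factor vanishes at [x0], so continuity
    of the normal along the projection is enough, and the right side has differential
    [tangent_proj N]. *)
Lemma is_diff_proj : is_diff x0 (proj_bdry Omega) (fun u => u *m dproj r N L).
Proof.
have r0 : 0 < r := dist_gt0 oO gx0.
have xE := nbhs_singleton near_proj_unormal; rewrite -/y0 -/r -/N in xE.
have cY : {for x0, continuous (proj_bdry Omega)}  :=
  proj_bdry_continuous gx0.
have dN : is_diff y0 (unormal G) (fun v => v *m L) := is_diff_unormal dF.
pose W y := y - r *: (unormal G y - N).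
have dW : is_diff y0 W (fun v => v *m (1%:M - r *: L)).
  apply: (is_diff_ext (is_diffB (is_diff_id y0) (is_diffZ r (is_diff_subr N dN)))) => // v.
  by rewrite mulmxBr mulmx1 -scalemxAr.
apply: (is_diff_local_inverse focal_unit cY dW).
have dd : is_diff x0 (fun z => dist_bdry Omega z - r) (fun u => - dotv u N).
  apply: (is_diff_ext (is_diff_subr r (is_diff_dist oO gx0))) => // u.
  have -> : x0 - proj_bdry Omega x0 = - (r *: N) by rewrite {1}xE addrAC subrr add0r.
  by rewrite dotvZr dotvNr dotvZr mulrN mulKf// gt_eqF.
have cNY : {for x0, continuous (unormal G \o proj_bdry Omega)}.
  exact: (continuous_comp cY (is_diff_continuous dN)).
have dS : is_diff x0 (fun z => (dist_bdry Omega z - r) *: unormal G (proj_bdry Omega z))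
    (fun u => u *m (- (N^T *m N))).
  apply: is_diff_col => i.
  have ci : {for x0, continuous (fun z => unormal G (proj_bdry Omega z) 0 i)}.
    exact: (cvg_comp _ _ cNY (@coord_continuous R 1 n 0 i N)).
  have dr0 : dist_bdry Omega x0 - r = 0 by rewrite subrr.
  apply: (is_diff_ext (is_diff_scale0 ci dd dr0)) => u.
    by rewrite [RHS]mxE [RHS]mulrC.
  rewrite mulmxN mulmxA [u *m _]mx11_scalar -dotvE mul_scalar_mx -scaleNr [RHS]mxE.
  exact: mulrC.
have dR := is_diffD (is_diff_subr x0 (is_diff_id x0)) dS.
have dR2 : is_diff x0 (fun z => W (proj_bdry Omega z) - y0) (fun u => u *m tangent_proj N).
  apply: is_diff_near_eq (is_diff_ext dR (fun=> erefl) _) => [|u]; last first.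
    by rewrite /tangent_proj mulmxBr mulmx1 -mulmxN.
  apply: filterS near_proj_unormal => z zE.
  change ((z - x0) + (dist_bdry Omega z - r) *: unormal G (proj_bdry Omega z) =
    proj_bdry Omega z - r *: (unormal G (proj_bdry Omega z) - N) - y0).
  rewrite {1}zE {1}xE.
  move: (proj_bdry Omega z) (dist_bdry Omega z) (unormal G _) y0 r N => a b c d e f.
  by apply/rowP => i; rewrite !mxE; ring.
by apply: (is_diff_ext (is_diff_subr (- y0) dR2)) => // z; rewrite opprK subrK.
Qed.

Lemma dprojE : dproj r N L = tangent_proj N + r *: (dproj r N L *m L).
Proof.
have E : dproj r N L *m (1%:M - r *: L) = tangent_proj N.
  by rewrite /dproj mulmxKV// focal_unit.
by rewrite -{1}E mulmxBr mulmx1 -scalemxAr subrK.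
Qed.

(** [1%:M - r *: L] fixes the column [N^T], hence so does its inverse, and [tangent_proj N] kills
    it: the image of P is tangential. *)
Lemma dproj_normal : dproj r N L *m N^T = 0.
Proof.
have MN : (1%:M - r *: L) *m N^T = N^T.
  by rewrite mulmxBl mul1mx -scalemxAl (shape_normal dF) scaler0 subr0.
rewrite /dproj -mulmxA -{1}MN mulKmx ?focal_unit//.
exact: (tangent_proj_normal dF).
Qed.

(** Adding the two minimality inequalities of the feet of [z] and [w] gives monotonicity; take
    [z = x0 + t *: u], [w = x0] and divide by [t ^+ 2]. *)
Lemma dproj_ge0 u : 0 <= dotv (u *m dproj r N L) u.
Proof.
have mono z w : good_set Omega z -> good_set Omega w ->
    0 <= dotv (proj_bdry Omega z - proj_bdry Omega w) (z - w).
  move=> /proj_nearest gz /proj_nearest gw.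
  move: (proj_bdry Omega z) (proj_bdry Omega w) gz gw => a b za wb.
  have : dotv (z - a) (z - a) <= dotv (z - b) (z - b).
    by rewrite -enorm_le_sqr; exact: za.2 _ wb.1.
  have : dotv (w - b) (w - b) <= dotv (w - a) (w - a).
    by rewrite -enorm_le_sqr; exact: wb.2 _ za.1.
  rewrite !dotvBB !dotvBr !dotvBl [dotv a z]dotvC [dotv a w]dotvC.
  rewrite [dotv b z]dotvC [dotv b w]dotvC.
  move: (dotv z z) (dotv z a) (dotv z b) (dotv w w) (dotv w a) (dotv w b) (dotv a a) (dotv b b).
  by move=> *; lra.
apply/ler_addgt0Pr => e e0.
(* Makes the pairing of the differentiability error with [u] at most [t * e]. *)
pose K := n%:R * `|u| * `|u| + 1.
have K0 : 0 < K by rewrite ltr_wpDl// !mulr_ge0.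
have [d d0 dP] := (near_enorm x0 _).1 (is_diff_epsE is_diff_proj (divr_gt0 e0 K0)).
have [d2 d20 gd] := (near_enorm x0 _).1 (good_near gx0).
have u1 : 0 < enorm u + 1 by rewrite ltr_wpDl// enorm_ge0.
pose t := Num.min d d2 / (enorm u + 1).
have t0 : 0 < t by rewrite divr_gt0// lt_min d0.
have wz : x0 + t *: u - x0 = t *: u by rewrite addrAC subrr add0r.
have : enorm (t *: u) < Num.min d d2.
  rewrite enormZ gtr0_norm// /t mulrAC ltr_pdivrMr// ltr_pM2l ?lt_min ?d0//.
  by rewrite ltrDl.
rewrite lt_min => /andP[td td2].
have := dP (x0 + t *: u); rewrite wz => /(_ td) h.
have := mono (x0 + t *: u) x0; rewrite wz => m.
have {}m : 0 <= dotv (proj_bdry Omega (x0 + t *: u) - proj_bdry Omega x0) (t *: u).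
  by apply: m => //; apply: gd; rewrite wz.
have := dotv_le_norm (proj_bdry Omega (x0 + t *: u) - proj_bdry Omega x0 -
  (t *: u) *m dproj r N L) u.
move: m h; move: (proj_bdry _ _ - _) => v; rewrite dotvZr pmulr_rge0// => m h.
rewrite dotvBl -scalemxAl dotvZl => k.
have : n%:R * `|v - t *: (u *m dproj r N L)| * `|u| <= t * e.
  rewrite scalemxAl; apply: (@le_trans _ _ (n%:R * (e / K * `|t *: u|) * `|u|)).
    by rewrite ler_wpM2r// ler_wpM2l.
  rewrite normrZ gtr0_norm//.
  have K1 : n%:R * `|u| * `|u| = K - 1 by rewrite addrK.
  have -> : n%:R * (e / K * (t * `|u|)) * `|u| = t * e * ((K - 1) / K).
    by rewrite -K1; field; rewrite gt_eqF.
  have q1 : (K - 1) / K <= 1 by rewrite ler_pdivrMr// mul1r gerBl.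
  exact: ler_piMr (ltW (mulr_gt0 t0 e0)) q1.
move=> /(le_trans k); rewrite ler_norml => /andP[_].
move: (dotv _ _) m => a a0; rewrite lerBlDr; set b := dotv _ _ => ab.
rewrite -(pmulr_rge0 _ t0) mulrDr; apply: le_trans a0 _.
by rewrite addrC.
Qed.

Lemma laplacian_dist : laplacian (dist_bdry Omega) x0 = - \tr (dproj r N L *m L).
Proof.
have r0 : 0 < r := dist_gt0 oO gx0.
have dNY := is_diff_comp is_diff_proj (is_diff_unormal dF).
have xF : Filter (nbhs x0) := nbhs_filter x0.
rewrite /laplacian /mxtrace -sumrN; apply: eq_bigr => i _.
have /is_diff_coord[_ [_ /(_ i) dNi]] := dNY.
have dNi' := is_diffN dNi.
transitivity ('D_(delta_mx 0 i) (fun z => - unormal G (proj_bdry Omega z) 0 i) x0).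
  apply: near_eq_derive.
  have gn := good_near gx0; have un := near_proj_unormal.
  near=> z; have gz : good_set Omega z by near: z.
  rewrite (partial_is_diff i (is_diff_dist oO gz)).
  have zE : z = proj_bdry Omega z - dist_bdry Omega z *: unormal G (proj_bdry Omega z).
    by near: z.
  have dz := dist_gt0 oO gz.
  have -> : z - proj_bdry Omega z = - (dist_bdry Omega z *: unormal G (proj_bdry Omega z)).
    by rewrite {1}zE addrAC subrr add0r.
  by rewrite scalerN scalerA mulVf ?gt_eqF// scale1r mxE.
have [dd dv] := is_diff_is_derive (delta_mx 0 i) dNi'.
rewrite [LHS]dv /=.
change (- (((delta_mx 0 i : 'rV[R]_n) *m dproj r N L *m L) 0 i) = - (dproj r N L *m L) i i).
by rewrite -mulmxA -rowE mxE.
Unshelve. all: by end_near. Qed.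
End ProjDiff.

(** For [r * C < 1 / 2] the equation for [P] bounds each of its rows by twice the corresponding row
    of [tangent_proj N]. Only this equation is assumed of [P], so [K] and [e] are fixed before a
    good point is chosen. *)
Lemma trace_dproj_bounded (R : realType) n (N : 'rV[R]_n) (L : 'M[R]_n) :
  exists K e, 0 < e /\ forall r P, 0 < r -> r < e ->
    P = tangent_proj N + r *: (P *m L) -> \tr (P *m L *m L) <= K.
Proof.
have [C C0 LC] := mulmx_le_norm L.
have [D D0 LD] := mulmx_le_norm (L *m L).
exists (\sum_i D * (2 * `|row i (tangent_proj N)|)), (1 / 2 / C).
split=> [|r P r0]; first by rewrite !divr_gt0.
rewrite ltr_pdivlMr// => rC PE.
apply: ler_sum => i _.
have -> : (P *m L *m L) i i = (row i P *m (L *m L)) 0 i.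
  by rewrite -mulmxA -row_mul [RHS]mxE.
apply: le_trans (le_trans (ler_norm _) (coord_le_norm _ _)) _.
apply: (le_trans (LD _)); rewrite ler_wpM2l ?(ltW D0)//.
have rE : row i P = row i (tangent_proj N) + r *: (row i P *m L).
  by rewrite {1}PE linearD linearZ /= row_mul.
have h1 : `|row i P| <= `|row i (tangent_proj N)| + r * (C * `|row i P|).
  rewrite {1}rE (le_trans (ler_normD _ _))// lerD2l normrZ gtr0_norm//.
  by rewrite ler_wpM2l ?(ltW r0).
have h2 : r * (C * `|row i P|) <= 1 / 2 * `|row i P|.
  by rewrite mulrA ler_wpM2r// ltW.
by move: `|row i P| `|row i (tangent_proj N)| (r * _) h1 h2 => a b c; lra.
Qed.

Section TraceProj.
Context (R : realType) (n : nat) (Omega : set 'rV[R]_n).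
Hypothesis oO : open Omega.
Context (x0 : 'rV[R]_n).
Hypothesis gx0 : good_set Omega x0.
Let y0 := proj_bdry Omega x0.
Let r := dist_bdry Omega x0.
Context (F : 'rV[R]_n -> R) (G : 'rV[R]_n -> 'rV[R]_n) (q : 'rV[R]_n).
Hypothesis dF : defining_function Omega y0 F G q.
Let N := unormal G y0.
Let L := shape_operator G y0.
Let P := dproj r N L.

Lemma trace_dproj : \tr (P *m L) = \tr L + r * \tr (P *m L *m L).
Proof.
have TL : \tr (tangent_proj N *m L) = \tr L := mxtrace_shape dF.
have PE : P = tangent_proj N + r *: (P *m L) := dprojE oO gx0 dF.
by rewrite {1}PE mulmxDl -scalemxAl mxtraceD mxtraceZ TL.
Qed.

(** Inserting the tangent projection replaces [L] by its symmetric part [S = tangent_proj N *m L];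
    then tr (PLL) = tr (SPS) is the sum over the rows of [S] of the quadratic form of P. *)
Lemma trace_dproj_sqr_ge0 : 0 <= \tr (P *m L *m L).
Proof.
have PN : P *m N^T = 0 := dproj_normal oO gx0 dF.
have PT : P *m tangent_proj N = P.
  by rewrite /tangent_proj mulmxBr mulmx1 mulmxA PN mul0mx subr0.
have LT : L *m tangent_proj N = L := shape_proj dF.
have Ssym : (tangent_proj N *m L)^T = tangent_proj N *m L := shape_sym dF.
set S := tangent_proj N *m L in Ssym.
have PL : P *m L = P *m S by rewrite /S mulmxA PT.
have -> : P *m L *m L = P *m S *m S.
  by rewrite PL /S -!mulmxA (mulmxA L) LT.
rewrite mxtrace_mulC mulmxA; apply: sumr_ge0 => i _.
have -> : (S *m P *m S) i i = dotv (row i S *m P) (row i S).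
  rewrite dotvE tr_row Ssym -row_mul [LHS]mxE [RHS]mxE.
  by apply: eq_bigr => j _; rewrite [in RHS]mxE [col i S j 0]mxE.
exact: (dproj_ge0 oO gx0 dF).
Qed.
End TraceProj.

(** Membership of [b] in the ball reads |b - a|^2 + 2r (b - a).N <= 0, while the quadratic bound
    makes the left side at least (1 - 2rK) |b - a|^2. *)
Lemma touching_uniq (R : realType) n (x a b N : 'rV[R]_n) (r K : R) :
    dotv N N = 1 -> x = a - r *: N -> 0 <= r -> 2 * r * K < 1 ->
    `|dotv (b - a) N| <= K * enorm (b - a) ^+ 2 -> enorm (x - b) <= r ->
  b = a.
Proof.
move=> NN xE r0 rK ab xb.
apply/eqP; rewrite -subr_eq0 -dotv_eq0 eq_le dotv_ge0 andbT leNgt; apply/negP.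
rewrite sqr_enorm in ab; move=> ba0.
have : dotv (x - b) (x - b) <= r ^+ 2.
  by rewrite -sqr_enorm ler_sqr ?nnegrE ?enorm_ge0.
have -> : x - b = - ((b - a) + r *: N) by rewrite xE opprD opprB addrAC.
rewrite dotvNl dotvNr opprK dotvDD dotvZr dotvZl dotvZr NN mulr1 -expr2.
rewrite gerDr => h.
have : 2 * (r * K) * dotv (b - a) (b - a) < dotv (b - a) (b - a).
  by rewrite gtr_pMl// mulrA.
move: h ab; rewrite ler_norml => h /andP[/(ler_wpM2l r0) ab _]; move: h ab.
rewrite mulrN [r * (K * _)]mulrA -[2 * (r * K) * _]mulrA.
move: (r * dotv _ N) (dotv (b - a) (b - a)) ba0 => p s s0.
by move: (r * K * s) => t; lra.
Qed.

(** * Good points near a boundary point *)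

Section NearBoundary.
Context (R : realType) (n : nat) (Omega : set 'rV[R]_n).
Hypothesis oO : open Omega.
Context (y0 : 'rV[R]_n) (F : 'rV[R]_n -> R) (G : 'rV[R]_n -> 'rV[R]_n) (q : 'rV[R]_n).
Hypothesis dF : defining_function Omega y0 F G q.
Hypothesis by0 : bdry Omega y0.

(** [F] vanishes at both points, so the Taylor estimate bounds [dotv (b - a) (G a)]. Normalizing
    divides by [enorm (G a)], which is at least the inverse of [enorm q]; hence the constant
    [K * enorm q]. *)
Lemma near_bdry_quadratic : exists K e, [/\ 0 <= K, 0 < e & forall a b,
  enorm (a - y0) < e -> enorm (b - y0) < e -> bdry Omega a -> bdry Omega b ->
  defining_function Omega a F G q /\
  `|dotv (b - a) (unormal G a)| <= K * enorm (b - a) ^+ 2].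
Proof.
have [K [e [K0 e0 Ke]]] := defining_taylor dF.
have [d d0 Hd] := (near_enorm y0 _).1 (defining_recenter dF).
exists (K * enorm q), (Num.min e d); split; first by rewrite mulr_ge0 ?enorm_ge0.
  by rewrite lt_min e0.
move=> a b; rewrite !lt_min => /andP[ae ad] /andP[be bd] ba bb.
have da := Hd _ ad; have db := Hd _ bd; split=> //.
have := Ke _ _ ae be.
rewrite ((bdry_defining oO da).1 ba) ((bdry_defining oO db).1 bb) subr0 sub0r normrN.
have Ga := defining_grad_gt0 a dF.
have qG : 1 <= enorm q * enorm (G a).
  have := dotv_cauchy q (G a); rewrite (defining_grad_q a dF) normrN1; exact.
move=> h; rewrite /unormal dotvZr normrM gtr0_norm ?invr_gt0// mulrC ler_pdivrMr//.
apply: (le_trans h).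
have -> : K * enorm q * enorm (b - a) ^+ 2 * enorm (G a) =
  K * (enorm (b - a) ^+ 2 * (enorm q * enorm (G a))) by ring.
by rewrite ler_wpM2l// ler_peMr// sqr_ge0.
Qed.

Lemma near_bdry_uniq : exists2 e, 0 < e & forall x a b r,
  enorm (a - y0) < e -> enorm (b - y0) < e -> bdry Omega a -> bdry Omega b ->
  defining_function Omega a F G q /\
  (x = a - r *: unormal G a -> 0 <= r -> r < e -> enorm (x - b) <= r -> b = a).
Proof.
have [K [e [K0 e0 Ke]]] := near_bdry_quadratic.
have K1 : 0 < 2 * K + 1 by rewrite ltr_wpDl// mulr_ge0.
(* Ensures [2 * r * K < 1] for [r] below this radius. *)
exists (Num.min e (1 / (2 * K + 1))) => [|x a b r]; first by rewrite lt_min e0 divr_gt0.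
rewrite !lt_min => /andP[ae _] /andP[be _] ba bb.
have [da quad] := Ke _ _ ae be ba bb; split=> // xE r0 /andP[_ rK] xb.
apply: (touching_uniq (dotv_unormal da a) xE r0 _ quad xb).
move: rK; rewrite ltr_pdivlMr// mulrDr mulr1 => h.
apply: le_lt_trans h; rewrite -[leLHS]addr0 lerD//.
by rewrite mulrAC [2 * K]mulrC mulrA [r * K]mulrC mulrAC mulrC.
Qed.

Lemma near_bdry_good : exists2 e, 0 < e &
  forall x, Omega x -> enorm (x - y0) < e -> good_set Omega x.
Proof.
have [e e0 He] := near_bdry_uniq.
have e20 : 0 < e / 2 by rewrite divr_gt0.
(* Half the radius: [y0] competes for the nearest point of [z], so every nearest point is within
   twice [enorm (z - y0)] of [y0]. *)
exists (e / 2) => // x Ox xe.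
pose U := Omega `&` [set z | enorm (z - y0) < e / 2].
exists U => //; split=> [| |z [Oz ze]].
- apply: openI => //.
  have cy : continuous (fun z : 'rV[R]_n => enorm (z - y0)) := @continuous_edist R n y0.
  exact: (@open_comp _ _ _ [set t | t < e / 2] (fun z _ => cy z) (@open_lt R (e / 2))).
- by move=> z [].
have [y zy] := nearest_exists z (@closed_bdry R n Omega) (ex_intro _ y0 by0).
have close a : nearest_point (bdry Omega) z a -> enorm (a - y0) < e /\ enorm (z - a) < e.
  move=> za; have zae := le_lt_trans (za.2 _ by0) ze.
  split; last by apply: lt_trans zae _; rewrite ltr_pdivrMr// ltr_pMr// ltr1n.
  apply: le_lt_trans (enorm_triangle _ z _) _.
  by rewrite (splitr e) ltrD// enormBC.
exists y; split=> // b zb.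
have [ye zye] := close _ zy; have [be zbe] := close _ zb.
have [dy uniq] := He z y b (enorm (z - y)) ye be zy.1 zb.1.
apply/esym/uniq => //; first exact: (nearest_unormal oO Oz zy dy).
  exact: enorm_ge0.
exact: zb.2 _ zy.1.
Qed.

(** Approaching [y0] along its inner normal keeps the foot, and with it [L], fixed while the
    distance tends to 0. *)
Lemma near_bdry_normal_points : \forall t \near (0 : R)^'+,
  [/\ good_set Omega (y0 - t *: unormal G y0),
      proj_bdry Omega (y0 - t *: unormal G y0) = y0 &
      dist_bdry Omega (y0 - t *: unormal G y0) = t].
Proof.
have [e e0 He] := near_bdry_uniq.
have [d d0 Hd] := near_bdry_good.
have F0 : F y0 = 0 := (bdry_defining oO dF).1 by0.
have [_ _ ON] := outward_unormal dF oO F0.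
near=> t.
have t0 : 0 < t by near: t; exact: nbhs_right_gt.
(* The foot of [y0 - t *: unormal G y0] lies within [2 * t] of [y0], hence where uniqueness
   applies. *)
have te : t < e / 2 by near: t; apply: nbhs_right_lt; rewrite divr_gt0.
have td : t < d by near: t; exact: nbhs_right_lt.
have [Ox _] : Omega (y0 - t *: unormal G y0) /\ ~ closure Omega (y0 + t *: unormal G y0).
  by near: t.
have xy : enorm (y0 - t *: unormal G y0 - y0) = t.
  by rewrite addrAC subrr add0r enormN enormZ (enorm_unormal dF) mulr1 gtr0_norm.
have gx : good_set Omega (y0 - t *: unormal G y0) by apply: Hd => //; rewrite xy.
have px := proj_nearest gx.
have xp : enorm (y0 - t *: unormal G y0 - proj_bdry Omega (y0 - t *: unormal G y0)) <= t.
  by rewrite -{3}xy; exact: px.2 _ by0.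
have py : proj_bdry Omega (y0 - t *: unormal G y0) = y0.
  have bp := px.1; move: (proj_bdry _ _) xp bp => b xp bp.
  have te' : t < e by apply: lt_trans te _; rewrite ltr_pdivrMr// ltr_pMr// ltr1n.
  have [||_ uniq] := He (y0 - t *: unormal G y0) y0 b t _ _ by0 bp.
  - by rewrite subrr enorm0.
  - apply: le_lt_trans (enorm_triangle _ (y0 - t *: unormal G y0) _) _.
    rewrite xy enormBC (splitr e) ltrD//; exact: le_lt_trans te.
  by apply: uniq => //; exact: ltW.
split=> //; by rewrite (dist_proj oO gx) py xy.
Unshelve. all: by end_near. Qed.
End NearBoundary.

(** * The mean curvature *)

(** Both the Hermitian form of [A] at the eigenvector and the squared length [s] are self-conjugate,
    and the former is [a * s] with [s != 0]. *)
Lemma symmetric_eigenvalue_real (R : realType) n (A : 'M[R]_n) (a : R[i]%C) :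
  A^T = A -> eigenvalue (map_mx (real_complex R) A) a -> a = (complex.Re a)%:C%C.
Proof.
move=> As /eigenvalueP[v vA v0].
pose w := map_mx conjc v; pose AC := map_mx (real_complex R) A.
pose s := (v *m w^T) 0 0.
have wv : map_mx conjc w = v by apply/matrixP => i j; rewrite !mxE conjcK.
have ACr : map_mx conjc AC = AC by apply/matrixP => i j; rewrite !mxE conjc_real.
have ACs : AC^T = AC by rewrite map_trmx As.
have qE : (v *m AC *m w^T) 0 0 = a * s by rewrite vA -scalemxAl mxE.
have qr : conjc ((v *m AC *m w^T) 0 0) = (v *m AC *m w^T) 0 0.
  transitivity ((map_mx conjc (v *m AC *m w^T)) 0 0); first by rewrite [RHS]mxE.
  rewrite !map_mxM /= -/w ACr -map_trmx wv.
  transitivity ((w *m AC *m v^T)^T 0 0); first by rewrite [RHS]mxE.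
  by rewrite !trmx_mul trmxK ACs mulmxA.
have sr : conjc s = s.
  transitivity ((map_mx conjc (v *m w^T)) 0 0); first by rewrite [RHS]mxE.
  rewrite map_mxM /= -/w -map_trmx wv.
  transitivity ((w *m v^T)^T 0 0); first by rewrite [RHS]mxE.
  by rewrite trmx_mul trmxK.
have s0 : s != 0.
  apply: contra_neq v0 => /eqP; rewrite /s mxE psumr_eq0 => [|i _]; last first.
    by rewrite !mxE mulcJ_ge0.
  move=> /allP h; apply/rowP => i; rewrite mxE.
  have := h i (mem_index_enum i); rewrite !mxE mulf_eq0 conjc_eq0 orbb.
  by move=> /eqP.
have : conjc a * s = a * s by rewrite -qE -[RHS]qr qE rmorphM /= sr.
move=> /(mulIf s0); case: a {vA qE} => x y [] /eqP.
by rewrite eq_sym -addr_eq0 -mulr2n mulrn_eq0 /= => /eqP ->.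
Qed.

(** Split the polynomial over the complex numbers, where every root is real, and descend by
    injectivity of the embedding. Principal curvatures are defined by such a splitting. *)
Lemma symmetric_char_poly (R : realType) n (A : 'M[R]_n) : A^T = A ->
  exists k : 'rV[R]_n, char_poly A = \prod_(i < n) ('X - (k 0 i)%:P).
Proof.
move=> As; pose f := real_complex R.
have [rs rsE] := closed_field_poly_normal (map_poly f (char_poly A)).
have pm : map_poly f (char_poly A) \is monic by rewrite map_monic char_poly_monic.
rewrite (monicP pm) scale1r in rsE.
pose ks := map (@complex.Re R) rs.
have rsk : rs = map f ks.
  rewrite -map_comp map_id_in// => z zrs /=; apply/esym.
  apply: symmetric_eigenvalue_real As _.
  rewrite eigenvalue_root_char -map_char_poly rsE.
  by rewrite root_prod_XsubC.
have kE : char_poly A = \prod_(z <- ks) ('X - z%:P).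
  apply: (map_poly_inj f); rewrite rsE rsk big_map rmorph_prod.
  by apply: eq_bigr => z _; rewrite rmorphB /= map_polyX map_polyC.
have sk : size ks = n.
  by have := size_char_poly A; rewrite kE size_prod_XsubC => -[].
exists (\row_i nth 0 ks i); rewrite kE (big_nth 0) big_mkord sk.
by apply: eq_bigr => i _; rewrite mxE.
Qed.

(** The reflection along [N - e] exchanges the unit vectors [e] and [N]; it degenerates only for
    [N = e], where the identity serves. Its other rows will span the tangent space. *)
Lemma householder (R : realType) n (N : 'rV[R]_n.+1) : dotv N N = 1 ->
  exists H : 'M[R]_n.+1, H *m H^T = 1%:M /\ row 0 H = N.
Proof.
move=> NN; pose e : 'rV[R]_n.+1 := delta_mx 0 0.
have ee : dotv e e = 1 by rewrite dotv_deltar mxE !eqxx.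
have [->|Ne] := eqVneq N e.
  by exists 1%:M; rewrite trmx1 mulmx1 row1.
have [v vE] : exists v, v = N - e by exists (N - e).
pose c := 2 / dotv v v.
have v0 : dotv v v != 0 by rewrite dotv_eq0 vE subr_eq0.
have ev : dotv e v = - (dotv v v / 2).
  by rewrite vE dotvBB NN ee dotvBr ee [dotv e N]dotvC; field.
exists (1%:M - c *: (v^T *m v)); split.
  have vvv : v^T *m v *m (v^T *m v) = dotv v v *: (v^T *m v).
    rewrite -mulmxA [v *m _]mulmxA [v *m v^T]mx11_scalar -dotvE mul_scalar_mx.
    by rewrite -scalemxAr.
  have -> : (1%:M - c *: (v^T *m v))^T = 1%:M - c *: (v^T *m v).
    by rewrite [LHS]linearB /= trmx1 linearZ /= trmx_mul trmxK.
  rewrite mulmxBl mul1mx mulmxBr mulmx1.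
  rewrite -scalemxAl -scalemxAr vvv !scalerA.
  have -> : c * c * dotv v v = 2 * c by rewrite -mulrA [c * dotv v v]divfK// mulrC.
  by apply/matrixP => i j; rewrite !mxE; ring.
rewrite rowE mulmxBr mulmx1 -/e -scalemxAr mulmxA [e *m v^T]mx11_scalar -dotvE.
rewrite mul_scalar_mx scalerA ev /c mulrN scaleNr opprK.
have -> : 2 / dotv v v * (dotv v v / 2) = 1 by field.
by rewrite scale1r vE addrC subrK.
Qed.

Lemma orthonormal_complement (R : realType) n (N : 'rV[R]_n.+1) : dotv N N = 1 ->
  exists B : 'M[R]_(n, n.+1), B *m B^T = 1%:M /\ B *m N^T = 0.
Proof.
move=> /householder[H [HH HN]]; exists (row' 0 H); split.
  have -> : row' 0 H *m (row' 0 H)^T = row' 0 (col' 0 (H *m H^T)).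
    by apply/matrixP => i j; rewrite !mxE; apply: eq_bigr => k _; rewrite !mxE.
  rewrite HH; apply/matrixP => i j; rewrite !mxE.
  by rewrite (inj_eq lift_inj).
apply/matrixP => i j; rewrite -HN.
transitivity ((H *m H^T) (lift 0 i) 0).
  by rewrite !mxE; apply: eq_bigr => k _; rewrite !mxE.
by rewrite HH !mxE.
Qed.

(** [N] stacked on [B] is an orthogonal square matrix [H], and [H^T *m H = 1%:M] reads
    [N^T *m N + B^T *m B = 1%:M]. *)
Lemma orthonormal_basis_proj (R : realType) n (N : 'rV[R]_n.+1) (B : 'M[R]_(n, n.+1)) :
  dotv N N = 1 -> B *m B^T = 1%:M -> B *m N^T = 0 -> B^T *m B = tangent_proj N.
Proof.
move=> NN BB BN.
pose H : 'M[R]_(1 + n) := col_mx N B.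
have HH : H *m H^T = 1%:M.
  rewrite /H tr_col_mx mul_col_row BB BN [N *m N^T]mx11_scalar -dotvE NN.
  by rewrite -[N *m B^T]trmxK trmx_mul trmxK BN trmx0 -scalar_mx_block.
have := mulmx1C HH; rewrite /H tr_col_mx mul_row_col => E.
by apply/eqP; rewrite /tangent_proj eq_sym subr_eq addrC E.
Qed.

(** * The mean curvature as the trace of [L] *)

Section MeanCurvature.
Context (R : realType) (n : nat) (Omega : set 'rV[R]_n.+1).
Hypothesis oO : open Omega.
Context (y : 'rV[R]_n.+1) (F : 'rV[R]_n.+1 -> R) (G : 'rV[R]_n.+1 -> 'rV[R]_n.+1).
Context (q : 'rV[R]_n.+1).
Hypothesis dF : defining_function Omega y F G q.
Hypothesis byy : bdry Omega y.
Let N := unormal G y.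
Let L := shape_operator G y.
Let F0 : F y = 0 := (bdry_defining oO dF).1 byy.

(** Any two extensions of the normal agree on the boundary, so differentiating along a boundary
    curve of velocity [w] gives the same vector. Principal curvatures are thus independent of the
    extension. *)
Lemma normal_extension_diff N' w : differentiable N' y ->
    (\forall z \near y, bdry Omega z -> outward_unit_normal Omega z (N' z)) ->
    tangent_vector (bdry Omega) y w -> 'd N' y w = w *m L.
Proof.
move=> dN' N'n /(tangent_defining _ oO dF F0) w0.
pose g := graph_curve F y q w.
have g0 : g 0 = y by exact: graph_curve0.
have dg : is_diff 0 g (fun s => s *: w).
  have := graph_curve_is_diff y q w 0 (defining_grad dF).
  by rewrite scale0r addr0 w0 scale0r addr0.
have d1 : is_diff (g 0) N' ('d N' y) by rewrite g0; exact: DiffDef.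
have d2 : is_diff (g 0) (unormal G) (fun v => v *m L).
  by rewrite g0; exact: (is_diff_unormal dF).
have cg : {for 0, continuous g} := is_diff_continuous dg.
have near1 : \forall t \near 0, bdry Omega (g t) -> outward_unit_normal Omega (g t) (N' (g t)).
  by apply: (cg [set z | bdry Omega z -> outward_unit_normal Omega z (N' z)]); rewrite g0.
have near2 : \forall t \near 0, defining_function Omega (g t) F G q.
  apply: (cg [set z | defining_function Omega z F G q]); rewrite g0.
  exact: (defining_recenter dF).
have near3 := near_graph_curve_bdry w oO dF F0.
have Ng : {near 0, N' \o g =1 unormal G \o g}.
  near=> t => /=.
  have bt : bdry Omega (g t) by near: t.
  have dt : defining_function Omega (g t) F G q by near: t.
  have ot : outward_unit_normal Omega (g t) (N' (g t)) by move: bt; near: t.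
  exact: (outward_unit_normalE _ oO dt ((bdry_defining oO dt).1 bt)).1.
have e1 := is_diff_near_eq Ng (is_diff_comp dg d1).
have := congr1 (fun f => f (1 : R)) (is_diff_uniq e1 (is_diff_comp dg d2)).
by rewrite /= scale1r.
Unshelve. all: by end_near. Qed.

Lemma curvature_matrixE N' (B : 'M[R]_(n, n.+1)) : differentiable N' y ->
    (\forall z \near y, bdry Omega z -> outward_unit_normal Omega z (N' z)) ->
    (forall i, tangent_vector (bdry Omega) y (row i B)) ->
  \matrix_(i, j) dotv ('d N' y (row i B)) (row j B) = B *m L *m B^T.
Proof.
move=> dN' N'n BT; apply/matrixP => i j; rewrite mxE (normal_extension_diff dN' N'n)//.
rewrite dotvE -row_mul tr_row [LHS]mxE [RHS]mxE.
by apply: eq_bigr => k _; rewrite [row _ _ _ _]mxE [col _ _ _ _]mxE.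
Qed.

Lemma tangent_basis_normal (B : 'M[R]_(n, n.+1)) :
  (forall i, tangent_vector (bdry Omega) y (row i B)) <-> B *m N^T = 0.
Proof.
have e i : dotv (row i B) N = (B *m N^T) i 0.
  by rewrite dotvE -row_mul [LHS]mxE.
split=> [BT|BN i].
  apply/matrixP => i j; rewrite (ord1 j) -e [RHS]mxE.
  by apply/(dotv_unormal_eq0 dF)/(tangent_defining _ oO dF F0).
apply/(tangent_defining _ oO dF F0)/(dotv_unormal_eq0 dF).
by rewrite -/N e BN mxE.
Qed.

(** The sum is read off the subleading coefficient of the characteristic polynomial, and tr (B L
    B^T) = tr (B^T B L) = tr (Pi L) = tr L. *)
Lemma sum_principal_curvatures k : are_principal_curvatures Omega y k ->
  \sum_(i < n) k 0 i = \tr L.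
Proof.
move=> [N' [B [dN' N'n BB BT]]]; rewrite (curvature_matrixE dN' N'n BT) => charE.
have BN := (tangent_basis_normal B).1 BT.
have <- : \tr (B *m L *m B^T) = \tr L.
  rewrite mxtrace_mulC mulmxA (orthonormal_basis_proj (dotv_unormal dF y) BB BN).
  exact: (mxtrace_shape dF).
(* The trace is a coefficient of the characteristic polynomial only in positive dimension; for
   [n = 0] both sums are empty. *)
have [n0|n0] := posnP n.
  have no_ord (i : 'I_n) : False by have := leq_ltn_trans (leq0n i) (ltn_ord i); rewrite [X in (_ < X)%N]n0.
  by rewrite /mxtrace !big1// => i; case: (no_ord i).
apply: oppr_inj; rewrite -(char_poly_trace _ n0) charE.
pose ks := [seq k 0 i | i <- enum 'I_n].
have sk : size ks = n by rewrite size_map size_enum_ord.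
have -> : \prod_(i < n) ('X - (k 0 i)%:P) = \prod_(z <- ks) ('X - z%:P).
  by rewrite big_map big_enum.
have := @coefPn_prod_XsubC R ks; rewrite sk -lt0n => -> //.
by rewrite big_map big_enum.
Qed.

(** Without existence [principal_curvatures] would take its dummy value. The matrix in an
    orthonormal tangent basis is symmetric because [B] absorbs the projection in
    [tangent_proj N *m L]. *)
Lemma principal_curvatures_exist : exists k, are_principal_curvatures Omega y k.
Proof.
have [B [BB BN]] := orthonormal_complement (dotv_unormal dF y).
have BT := (tangent_basis_normal B).2 BN.
have Nn : \forall z \near y, bdry Omega z -> outward_unit_normal Omega z (unormal G z).
  apply: filterS (defining_recenter dF) => z dz bz.
  exact: (outward_unormal dz oO ((bdry_defining oO dz).1 bz)).
have [dN _] := is_diff_unormal dF.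
have sym : (B *m L *m B^T)^T = B *m L *m B^T.
  have BP : B *m tangent_proj N = B.
    by rewrite /tangent_proj mulmxBr mulmx1 mulmxA BN mul0mx subr0.
  have E : B *m L *m B^T = B *m (tangent_proj N *m L) *m B^T.
    by rewrite mulmxA BP.
  by rewrite E trmx_mul trmxK trmx_mul (shape_sym dF) mulmxA.
have [k kE] := symmetric_char_poly sym.
exists k, (unormal G), B; split=> //.
by rewrite (curvature_matrixE dN Nn BT).
Qed.

Lemma mean_curvatureE : mean_curvature Omega y = \tr L.
Proof.
have [k kP] := principal_curvatures_exist.
apply: sum_principal_curvatures.
exact: (xgetPex 0 (ex_intro (fun k => are_principal_curvatures Omega y k) k kP)).
Qed.
End MeanCurvature.

Theorem theorem1p7 (R : realType) (n : nat) (hn : (1 <= n)%N)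
  (Omega : set 'rV[R]_n.+1)
  (Omega_open : open Omega) (Omega_connected : connected Omega)
  (bdry_neq0 : bdry Omega !=set0) (bdry_C2 : C2_boundary Omega) :
  (forall x, (Omega `\` singular_set Omega) x ->
     0 <= - laplacian (dist_bdry Omega) x)
  <-> weakly_mean_convex Omega.
Proof.
rewrite /singular_set setDD; split=> [superh y0 by0|convex x [_ gx]].
  have [F [G [q dF]]] := C2_boundary_defining bdry_C2 by0.
  rewrite (mean_curvatureE Omega_open dF by0).
  set L := shape_operator G y0.
  have [K [e [e0 Ke]]] := trace_dproj_bounded (unormal G y0) L.
  rewrite leNgt; apply/negP => trL.
  have K1 : 0 < `|K| + 1 by rewrite ltr_wpDl.
  near (0 : R)^'+ => t.
  have t0 : 0 < t by near: t; exact: nbhs_right_gt.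
  have te : t < e by near: t; exact: nbhs_right_lt.
  (* For such [t] one has [\tr L + t * |K| < 0], contradicting superharmonicity at
     [y0 - t *: unormal G y0]. *)
  have tK : t < - \tr L / (`|K| + 1).
    by near: t; apply: nbhs_right_lt; rewrite divr_gt0// oppr_gt0.
  have [gx px dx] : [/\ good_set Omega (y0 - t *: unormal G y0),
      proj_bdry Omega (y0 - t *: unormal G y0) = y0 &
      dist_bdry Omega (y0 - t *: unormal G y0) = t].
    by near: t; exact: (near_bdry_normal_points Omega_open dF by0).
  have dF' : defining_function Omega (proj_bdry Omega (y0 - t *: unormal G y0)) F G q.
    by rewrite px.
  have := superh _ (conj (good_sub gx) gx).
  rewrite (laplacian_dist Omega_open gx dF') opprK (trace_dproj Omega_open gx dF').
  have := dprojE Omega_open gx dF'.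
  rewrite px dx -/L => PE; have := Ke _ _ t0 te PE.
  move: (\tr (_ *m L *m L)) => p pK h.
  have : t * p <= t * `|K|.
    by rewrite ler_wpM2l ?(ltW t0)// (le_trans pK)// ler_norm.
  rewrite ltr_pdivlMr// mulrDr mulr1 in tK.
  by move: (t * `|K|) (t * p) (\tr L) tK h => a b c *; lra.
have px := proj_nearest gx.
have [F [G [q dF]]] := C2_boundary_defining bdry_C2 px.1.
have := convex _ px.1; rewrite (mean_curvatureE Omega_open dF px.1) => H0.
rewrite (laplacian_dist Omega_open gx dF) opprK (trace_dproj Omega_open gx dF).
rewrite addr_ge0// mulr_ge0//; first exact: ltW (dist_gt0 Omega_open gx).
exact: (trace_dproj_sqr_ge0 Omega_open gx dF).
Unshelve. all: by end_near. Qed.
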